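(* Let $\mathcal G=(V,E)$ be a finite graph with two distinct marked nodes $N$ and $F$. Assume that $\mathcal G$ is tree-like and that the edge $a=\{N,F\}$ belongs to $E$ with multiplicity $1$. Let $(W_e(n))_{e\in E,\,n\ge 0}$ be the edge-weights of the trace-reinforced ant process on $\mathcal G$. Then, almost surely when $n\to+\infty$, \[\frac{W_a(n)}{n}\to 1\quad\text{ and }\quad \frac{W_e(n)}{n}\to 0\ \text{ for all } e\in E\setminus\{a\}.\]
   Context: Trace-reinforced ant process. Let $\mathcal G=(V,E)$ be a finite undirected graph (parallel edges allowed; $E$ is then a multiset and each copy of an edge carries its own weight) with two distinct marked nodes $N$ (nest) and $F$ (food). Random weights $\mathbf W(n)=(W_e(n))_{e\in E}$, $n\ge 0$, are defined recursively. At time $0$, $W_e(0)=1$ for all $e\in E$. Given $\mathbf W(n)$ (and independently of the rest of the past), run a random walk on $\mathcal G$ started at $N$ and stopped when it first hits $F$; at each step, from a vertex $u\ne F$, it crosses an edge $e$ incident to $u$ with probability $W_e(n)/\sum_{e'\sim u}W_{e'}(n)$, where the sum is over the edges $e'$ incident to $u$ (the weights being kept fixed equal to $\mathbf W(n)$ during the whole walk). Let $\gamma(n+1)$ be the set of edges crossed at least once by this walk, and set $W_e(n+1)=W_e(n)+\mathbf 1_{e\in\gamma(n+1)}$ for all $e\in E$. Tree-like: a graph $\mathcal G=(V,E)$ with marked nodes $N$ and $F$ is tree-like if the graph whose vertex set is $V\setminus\{F\}$ and whose edge set is $E$ minus all edges that contain $F$ is a tree, i.e. a graph with no cycle (two parallel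 edges count as a cycle). *)

(* Defs.v *)
From HB Require Import structures.
From mathcomp Require Import all_boot all_order all_algebra.
From mathcomp Require Import all_classical all_reals all_analysis.

Set Implicit Arguments.
Unset Strict Implicit.
Unset Printing Implicit Defensive.

Import Order.TTheory GRing.Theory Num.Theory.
Import numFieldNormedType.Exports.

Local Open Scope classical_set_scope.
Local Open Scope ring_scope.

(* Finite undirected loopless multigraphs: parallel edges are distinct elements
   of [edge] with the same value of [ends]. *)
Record multigraph := Multigraph {
  vertex : finType;
  edge : finType;
  ends : edge -> {set vertex};
  ends_card : forall e, #|ends e| = 2%N }.

(* [vs] = v_0, ..., v_(l-1) and [es] = e_0, ..., e_(l-1), where l >= 2 and e_i
   joins v_i to v_(i+1 mod l). For l = 2 this is a pair of parallel edges. *)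
Definition is_cycle (G : multigraph) (vs : seq (vertex G)) (es : seq (edge G)) :
    bool :=
  [&& (1 < size vs)%N, uniq vs, uniq es &
      [seq ends e | e <- es] ==
      [seq [set uv.1; uv.2]%SET | uv <- zip vs (rot 1 vs)]].

(* The subgraph with vertex set A and edge set B is a tree in the sense of
   having no cycle; connectedness is not required. *)
Definition acyclic_on (G : multigraph) (A : {set vertex G}) (B : {set edge G}) :
    Prop :=
  forall vs es, all (fun v => v \in A) vs -> all (fun e => e \in B) es ->
    ~~ is_cycle vs es.

Definition tree_like (G : multigraph) (F : vertex G) : Prop :=
  acyclic_on [set v | v != F]%SET [set e : edge G | F \notin ends e]%SET.

Section Walk.
Variables (R : realType) (G : multigraph) (N F : vertex G).

(* The endpoint of e other than u (u itself when e has no other endpoint;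
   irrelevant if e is not incident to u). *)
Definition cross (u : vertex G) (e : edge G) : vertex G :=
  odflt u [pick v in ends e | v != u].

(* A stopped walk is encoded by the sequence of its moves: [Some e] when e is
   crossed, [None] from the time the walk has hit F on. *)
Definition position (s : seq (option (edge G))) : vertex G :=
  foldl (fun u o => if o is Some e then cross u e else u) N s.

Definition move_prob (w : edge G -> nat) (u : vertex G) (o : option (edge G)) :
    R :=
  match o with
  | Some e => if (u != F) && (u \in ends e) then
                (w e)%:R / \sum_(e' | u \in ends e') (w e')%:R
              else 0
  | None => if u == F then 1 else 0
  end.

End Walk.

Section AntProcess.
Context (R : realType) (d : measure_display) (T : measurableType d).
Variables (P : probability T R) (G : multigraph) (N F : vertex G).
(* X n k is the move made at step k by the walk run with the weights at time n;
   its trace [trace n] is reinforced at time n.+1. *)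
Variable X : nat -> nat -> T -> option (edge G).

Definition trace (n : nat) (t : T) : {set edge G} :=
  [set e | `[< exists k, X n k t = Some e >]]%SET.

Fixpoint weight (n : nat) (t : T) (e : edge G) : nat :=
  if n is m.+1 then (weight m t e + (e \in trace m t))%N else 1%N.

(* The sigma-algebra generated by the walks 0, ..., n-1. *)
Definition past (n : nat) : set (set T) :=
  <<s [set B | exists m k o, (m < n)%N /\ B = [set t | X m k t = o]] >>.

(* Conditionally on the weights at time n being w, on any event A of the past, and on the first
   moves s of the current walk, the next move has law [move_prob w] at the
   current position. As the moves take finitely many values, this is written
   in product form, without conditional expectations. *)
Definition ant_process : Prop :=
  (forall n k o, measurable [set t | X n k t = o]) /\
  forall n (A : set T) (w : {ffun edge G -> nat}) s o, past n A ->
    let H := A `&` [set t | weight n t =1 w]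
               `&` [set t | mkseq (fun k => X n k t) (size s) = s] in
    P (H `&` [set t | X n (size s) t = o]) =
    (P H * (move_prob R F w (position N s) o)%:E)%E.

End AntProcess.

(* Main.v *)
(** Let [S] be the total weight of the edges at [F], [A = W_a] and [m = 1 - A /
    S]. By reversibility, an edge [f = {v, F}] other than [a] is crossed with
    probability at most [w_f / A * (1 - w_f / W_v)] times that of crossing [a],
    with [W_v] the total weight at [v]; the last factor accounts for the walks
    from [v] that go directly to [F]. As exactly one edge at [F] is crossed,
    [a] is crossed with probability at least [A / S * (1 + k m^2)], where [k]
    depends only on the number of edges. In a tree-like graph an edge [e <> a]
    at [N] is first crossed from [N], hence with probability at most [w_e /
    (w_e + A)]. These two bounds make a suitable combination of [W_e / S], [S /
    A - 1] and [1 / S] a nonnegative supermartingale whose drift at time [n] is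
    at most [- V / S], with [V] of the order of [(W_e / S)^2 + m^2]. Since the
    harmonic series diverges, its expectation takes arbitrarily small values,
    and Doob's maximal inequality shows that it tends to [0] almost surely. The
    other edges are only crossed together with some [e <> a] at [N]. *)

Require Import Defs.
From HB Require Import structures.
From mathcomp Require Import all_boot all_order all_algebra.
From mathcomp Require Import all_classical all_reals all_analysis.
From mathcomp Require Import measurable_realfun.
From mathcomp Require Import ring lra.

Set Implicit Arguments.
Unset Strict Implicit.
Unset Printing Implicit Defensive.

Import Order.TTheory GRing.Theory Num.Theory.
Import numFieldNormedType.Exports.

Local Open Scope classical_set_scope.
Local Open Scope ring_scope.

(** * Walks in a multigraph *)

Section Walks.
Variables (G : multigraph) (N F : vertex G).
Implicit Types (u v : vertex G) (e f : edge G) (x : nat -> option (edge G)).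

Lemma ends_crossE u e : u \in ends e ->
  ends e = [set u; cross u e]%SET /\ cross u e != u.
Proof.
move=> ue; have /eqP/cards2P[y [z [yz eE]]] := ends_card e.
suff [v vu ve] : exists2 v, v != u & ends e = [set u; v]%SET.
  rewrite /cross; case: pickP => [w /andP[]|/(_ v)].
    by rewrite ve !inE => /orP[/eqP->|/eqP->]; rewrite ?eqxx.
  by rewrite ve !inE eqxx orbT vu.
move: ue; rewrite eE !inE => /orP[/eqP->|/eqP->]; first by exists z; rewrite 1?eq_sym.
by exists y => //; rewrite finset.setUC.
Qed.

Lemma mem_cross u e : u \in ends e -> cross u e \in ends e.
Proof. by move=> /ends_crossE[-> _]; rewrite !inE eqxx orbT. Qed.

Lemma cross_neq u e : u \in ends e -> cross u e != u.
Proof. by move=> /ends_crossE[]. Qed.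

Lemma cross_eq u v e : u \in ends e -> v \in ends e -> v != u -> cross u e = v.
Proof.
move=> /ends_crossE[eE _]; rewrite {1}eE !inE => /orP[/eqP->|/eqP->//].
by rewrite eqxx.
Qed.

Lemma crossK u e : u \in ends e -> cross (cross u e) e = u.
Proof.
move=> ue; apply: cross_eq => //; first exact: mem_cross.
by rewrite eq_sym cross_neq.
Qed.

Definition step u (o : option (edge G)) := if o is Some e then cross u e else u.

(** The moves to which [move_prob] gives positive probability at [u] when the weights are positive.
    Illegal moves turn out to have probability [0], so walks can be studied path by path. *)
Definition legal u (o : option (edge G)) :=
  if o is Some e then (u != F) && (u \in ends e) else u == F.

Definition pos x k := position N (mkseq x k).

Lemma position_rcons s o : position N (rcons s o) = step (position N s) o.
Proof. by rewrite /position -cats1 foldl_cat. Qed.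

Lemma posS x k : pos x k.+1 = step (pos x k) (x k).
Proof. by rewrite /pos mkseqS position_rcons. Qed.

Definition legal_walk x := forall k, legal (pos x k) (x k).

Section Legal.
Variables (x : nat -> option (edge G)) (xP : legal_walk x).

Lemma absorbed k j : (k <= j)%N -> pos x k = F -> pos x j = F /\ x j = None.
Proof.
move=> kj pk; have pF i : pos x (i + k)%N = F.
  elim: i => // i IH; have := xP (i + k); rewrite addSn posS IH /legal.
  by case: (x _) => [e|//]; rewrite eqxx.
have pj : pos x j = F by rewrite -(subnK kj) pF.
by split=> //; have := xP j; rewrite /legal; case: (x j) => // e; rewrite pj eqxx.
Qed.

Lemma pos_food k f : x k = Some f -> F \in ends f -> pos x k.+1 = F.
Proof.
move=> xk Ff; have := xP k; rewrite posS xk /= => /andP[uF uf].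
by apply: cross_eq; rewrite 1?eq_sym.
Qed.

Lemma food_last k j f e : x k = Some f -> F \in ends f -> x j = Some e ->
  (j <= k)%N.
Proof.
move=> xk Ff xj; rewrite leqNgt; apply/negP => kj.
by have [_] := absorbed kj (pos_food xk Ff); rewrite xj.
Qed.

(** Crossing an edge at [F] ends the walk, so both crossings happen at the same step. *)
Lemma food_uniq k j f f' : x k = Some f -> F \in ends f ->
  x j = Some f' -> F \in ends f' -> f = f'.
Proof.
move=> xk Ff xj Ff'; have kj : k = j.
  by apply/eqP; rewrite eqn_leq (food_last xk Ff xj) (food_last xj Ff' xk).
by move: xk; rewrite kj xj => -[].
Qed.

(** A walk whose first edge is [a] is then at [F] and crosses nothing else. This reduces the study
    of all edges other than [a] to those at [N]. *)
Lemma first_move (a : edge G) k e : N != F -> F \in ends a -> x k = Some e ->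
  e != a -> exists2 e', x 0 = Some e' & (N \in ends e') && (e' != a).
Proof.
move=> NF Fa xk ea; have := xP 0; rewrite /legal.
case x0: (x 0) => [e'|]; last by rewrite /pos/= /position/= (negPf NF).
move=> /andP[_ Ne']; exists e' => //; rewrite Ne'/=; apply/eqP => e'a.
rewrite e'a in x0; have := food_last x0 Fa xk; rewrite leqn0 => /eqP k0.
by move: xk ea; rewrite k0 x0 => -[->]; rewrite eqxx.
Qed.

Lemma pos_food_edge k : N != F -> pos x k = F ->
  exists j f, [/\ (j < k)%N, x j = Some f & F \in ends f].
Proof.
move=> NF; elim: k => [/eqP|k IH]; first by rewrite /pos/= /position/= (negPf NF).
have [pk _|pk] := eqVneq (pos x k) F.
  by have [j [f [jk xj Ff]]] := IH pk; exists j, f; split=> //; rewrite ltnS ltnW.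
have := xP k; rewrite posS; case xk : (x k) => [f|] /=; last by rewrite (negPf pk).
move=> /andP[_ uf] cF; exists k, f; split=> //; rewrite -cF; exact: mem_cross.
Qed.

End Legal.

(** Lifts a simple path of vertices to distinct edges, in the format of [is_cycle]; one more edge
    will close the cycle. *)
Lemma path_edges (r : rel (vertex G)) (B : pred (edge G)) v p :
  (forall y z, r y z -> exists2 e, B e & ends e = [set y; z]%SET) ->
  path r v p -> uniq (v :: p) ->
  exists es, [/\ all B es, uniq es &
    [seq ends e | e <- es] = [seq [set yz.1; yz.2]%SET | yz <- zip (belast v p) p]].
Proof.
move=> rB; elim: p v => [v _ _|z p IH v]; first by exists [::].
move=> /= /andP[vz zp] /andP[vp up].
have [es [Bes ues esE]] := IH z zp up; have [e Be eE] := rB _ _ vz.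
exists (e :: es); split => /=; first by rewrite Be.
(* [v] is an endpoint of [e], while the endpoints of the edges in [es] all lie in [z :: p], which
   does not contain [v]. *)
- rewrite ues andbT; apply/negP => ees.
  have : ends e \in [seq ends e | e <- es] by apply: map_f.
  rewrite esE => /mapP[[y1 y2] y12 /=]; rewrite eE => vE.
  have : v \in [set y1; y2]%SET by rewrite -vE !inE eqxx.
  have y1p : y1 \in z :: p.
    by apply: mem_belast; rewrite -(unzip1_zip (t := p) (s := belast z p)) ?size_belast//;
       exact: (map_f fst y12).
  have y2p : y2 \in z :: p.
    by rewrite inE -(unzip2_zip (t := p) (s := belast z p)) ?size_belast//;
       rewrite (map_f snd y12) orbT.
  by rewrite !inE => /orP[]/eqP vy; move: vp; rewrite vy (y1p, y2p).
- by rewrite esE eE.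
Qed.

(* Otherwise the walk reached the other endpoint of [e] without crossing [e],
   which together with [e] closes a cycle avoiding [F]. *)
Lemma first_crossing x k e : legal_walk x -> tree_like F -> N != F ->
  N \in ends e -> F \notin ends e -> (forall j, (j < k)%N -> x j != Some e) ->
  x k = Some e -> pos x k = N.
Proof.
move=> xP tF NF Ne Fe xNe xk; apply/eqP; apply: contraT => pkN.
pose B := [pred e' | (e' != e) && (F \notin ends e')].
pose r := [rel y z | [exists e', B e' && (ends e' == [set y; z]%SET)]].
have rB y z : r y z -> exists2 e', B e' & ends e' = [set y; z]%SET.
  by move=> /existsP[e' /andP[Be' /eqP]]; exists e'.
have /andP[pkF pke] : (pos x k != F) && (pos x k \in ends e).
  by have := xP k; rewrite xk.
(* Up to step [k] the walk has neither met [F] nor crossed [e], so it moves along edges of [B]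
   only. *)
have conn j : (j <= k)%N -> connect r N (pos x j).
  elim: j => [|j IH jk]; first by rewrite /pos/= /position/= connect0.
  apply: connect_trans (IH (ltnW jk)) _.
  have pjF : pos x j.+1 != F.
    by apply: contra pkF => /eqP pjF; have [->] := absorbed xP jk pjF.
  have := xP j; move: pjF; rewrite posS /=; case xj: (x j) => [e'|]/=; last first.
    by rewrite connect0.
  move=> cF /andP[pF pe']; apply: connect1; apply/existsP; exists e'.
  have [e'E _] := ends_crossE pe'; rewrite e'E eqxx andbT inE.
  apply/andP; split; first by apply: contra (xNe _ jk) => /eqP <-; rewrite xj.
  by rewrite e'E !inE negb_or ![F == _]eq_sym pF cF.
(* A simple path of edges of [B] from [N] to the position at step [k], which is the other endpoint
   of [e]. *)
have /connectP[p0 /shortenP[p rp up _] pkE] := conn k (leqnn k).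
have [es [Bes ues esE]] := path_edges rB rp up.
have p_gt0 : (0 < size p)%N by case: p pkE {up rp esE} => //= pk; rewrite pk eqxx in pkN.
have eE : ends e = [set pos x k; N]%SET.
  have [-> _] := ends_crossE pke; by rewrite (@cross_eq _ N) 1?eq_sym.
have BF e' : B e' -> F \notin ends e' by case/andP.
suff cyc : is_cycle (N :: p) (rcons es e).
  suff [vsF esF] : all (fun u => u \in [set v | v != F]%SET) (N :: p) /\
      all (fun e => e \in [set e : edge G | F \notin ends e]%SET) (rcons es e).
    by have := tF _ _ vsF esF; rewrite cyc.
  split.
    have: all (fun u => u != F) (N :: p).
      rewrite /= NF /=; elim: p {p_gt0 up pkE esE cyc} N rp => //= y p IH z.
      move=> /andP[/rB[e' /BF + e'E] yp].
      by rewrite e'E !inE negb_or ![F == _]eq_sym => /andP[_ ->]; rewrite (IH y).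
    by apply: sub_all => u; rewrite inE.
  rewrite all_rcons inE Fe /=; apply: sub_all Bes => e' /BF.
  by rewrite inE.
apply/and4P; split => //.
  rewrite rcons_uniq ues andbT; apply/negP => /(allP Bes)/andP[].
  by rewrite eqxx.
rewrite map_rcons esE eE rot1_cons lastI zip_rcons ?size_belast// map_rcons/=.
by rewrite -pkE.
Qed.

End Walks.

(** * The Lyapunov function *)

Section Lyapunov.
Context {R : realFieldType}.
Implicit Types (S A w x m p q k th eps : R).

Definition phi k S A := S / (A - 1 + k / 8).

(** With [m = 1 - A / S], the coefficient [36 / k] turns the decrease [k / 4 * m ^+ 2] of
    [phi_drift] into [9 * m ^+ 2]: this pays the [8 * m ^+ 2] of [ratio_drift] and leaves one for
    [dissip]. The last term compensates the error [4 / S ^+ 2] of [phi_drift]. The parameter [th]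
    switches the dependence on [w] on or off. *)
Definition lyap th k S A w :=
  th * (w / S) + 36 / k * (phi k S A - 1) + 8 * (36 / k) / S.

Definition dissip th k S A w := th * (w / S) ^+ 2 / 8 + (1 - A / S) ^+ 2 * phi k S A.

Lemma phi_ge1 k S A : 0 < k -> k <= 1 -> 1 <= A -> A <= S -> 1 <= phi k S A.
Proof. by move=> k0 k1 A1 AS; rewrite /phi ler_pdivlMr; lra. Qed.

(* The shift by [1 - k / 8] in the denominator of [phi] is what makes the drift
   negative for every [A >= 1]; [S / A] would only do for large [A]. *)
Lemma phi_drift k S A p : 0 < k -> k <= 1 / 2 -> 1 <= A -> A <= S ->
  0 <= p -> A <= p * (S - k * (1 - A / S) ^+ 2 * S) ->
  (S + 1) * (p / (A + k / 8) + (1 - p) / (A - 1 + k / 8)) <=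
  phi k S A - k / 4 * (1 - A / S) ^+ 2 / (A - 1 + k / 8) + 4 / S ^+ 2.
Proof.
move=> k0 k2 A1 AS p0; set m := 1 - A / S; move=> hp.
have S0 : 0 < S by lra.
have AE : A = S * (1 - m) by rewrite /m; field; lra.
have m1 : m <= 1 by rewrite /m gerBl; apply: divr_ge0; lra.
have m0 : 0 <= m by rewrite /m subr_ge0 ler_pdivrMr; lra.
(* Multiply the hypothesis by [1 + k * m ^+ 2] and use
   [(1 - k * m ^+ 2) * (1 + k * m ^+ 2) <= 1]. *)
have pS : A * (1 + k * m ^+ 2) <= p * S.
  apply: (@le_trans _ _ (p * (S - k * m ^+ 2 * S) * (1 + k * m ^+ 2))).
    apply: ler_wpM2r => //; have : 0 <= k * m ^+ 2 by apply: mulr_ge0; nra.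
    lra.
  have -> : p * (S - k * m ^+ 2 * S) * (1 + k * m ^+ 2) =
    p * S - p * S * (k * m ^+ 2) ^+ 2 by ring.
  by rewrite gerBl; apply: mulr_ge0; [nra|exact: sqr_ge0].
set q := A - 1 + k / 8; have q0 : 0 < q by rewrite /q; lra.
have -> : A + k / 8 = q + 1 by rewrite /q; ring.
have -> : (S + 1) * (p / (q + 1) + (1 - p) / q) =
    phi k S A + (q + 1 - (S + 1) * p) / (q * (q + 1)).
  by rewrite /phi -/q; field; apply/andP; split; lra.
have -> : phi k S A - k / 4 * m ^+ 2 / q + 4 / S ^+ 2 =
   phi k S A + (4 / S ^+ 2 - k / 4 * m ^+ 2 / q) by ring.
rewrite lerD2l.
have qq0 : 0 < q * (q + 1) by apply: mulr_gt0; lra.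
have km0 : 0 <= k * m ^+ 2 by apply: mulr_ge0; nra.
apply: (@le_trans _ _ ((k / 8 - k * m ^+ 2 * A) / (q * (q + 1)))).
  by rewrite ler_pM2r ?invr_gt0// /q; lra.
have S2 : 0 < 4 / S ^+ 2 by apply: divr_gt0; [lra|nra].
(* The term [k / 8] in the numerator is the price of the shift. For [m >= 1 / 2] the term in
   [m ^+ 2] absorbs it; for [m < 1 / 2], [A] is at least [S / 2] and the error [4 / S ^+ 2] covers
   it. *)
have [m2|m2] := leP (1 / 2) m.
  apply: (@le_trans _ _ (- (k / 4 * m ^+ 2 / q))); last by lra.
  rewrite ler_pdivrMr//.
  have -> : - (k / 4 * m ^+ 2 / q) * (q * (q + 1)) = - (k / 4 * m ^+ 2 * (q + 1)).
    by field; lra.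
  have mm : 1 / 4 <= m ^+ 2 by nra.
  have : k / 4 <= k * m ^+ 2 by nra.
  have -> : k / 4 * m ^+ 2 * (q + 1) = k * m ^+ 2 / 4 * (q + 1) by ring.
  move: km0; set z := k * m ^+ 2 => z0 zk.
  have h1 : k / 8 <= z / 2 * A by nra.
  have h2 : z / 4 * (q + 1) <= z / 2 * A.
    have -> : z / 4 * (q + 1) = z / 2 * ((q + 1) / 2) by field.
    by rewrite ler_wpM2l// /q; lra.
  by lra.
have q1 : k / 8 * A <= q by rewrite /q; nra.
have A2 : S / 2 <= A by nra.
rewrite mulrBl; apply: lerB.
  rewrite ler_pdivrMr// mulrAC ler_pdivlMr ?exprn_gt0//.
  have h1 : k / 8 * A * A <= q * (q + 1) by apply: ler_pM; rewrite /q; nra.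
  have h2 : S ^+ 2 <= 4 * (A * A) by rewrite expr2; nra.
  apply: (@le_trans _ _ (k / 8 * (4 * (A * A)))); last by lra.
  by rewrite ler_wpM2l//; lra.
rewrite ler_pdivlMr//.
have -> : k / 4 * m ^+ 2 / q * (q * (q + 1)) = k * m ^+ 2 / 4 * (q + 1).
  by field; lra.
by move: km0; set z := k * m ^+ 2 => z0; rewrite /q; nra.
Qed.

(** Here [x = w / S], [m = 1 - A / S], and the last hypothesis reads [p <= w / (w + A)]. Hence
    [p - x <= x * (m - x) / (x + 1 - m)], where [x * m <= (x ^+ 2 + m ^+ 2) / 2] and the denominator
    lies between [1 / 2] and [2] if [m <= 1 / 2]. For larger [m] the term [8 * m ^+ 2] exceeds
    [1 + x ^+ 2 / 4]. *)
Lemma ratio_drift x m p : 0 <= x -> x <= 1 -> 0 <= m -> p <= 1 ->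
  p * (x + 1 - m) <= x -> p - x <= 8 * m ^+ 2 - x ^+ 2 / 4.
Proof.
move=> x0 x1 m0 p1 px; have [m2|m2] := leP m (1 / 2); last by nra.
have D0 : 0 < x + 1 - m by lra.
rewrite -(ler_pM2r D0) mulrBl; apply: (le_trans (lerB px (lexx _))).
have -> : x - x * (x + 1 - m) = x * m - x ^+ 2 by ring.
have h : x * m - x ^+ 2 <= (m ^+ 2 - x ^+ 2) / 2 by have := sqr_ge0 (x - m); nra.
apply: (le_trans h).
have [h1|h1] := leP 0 (m ^+ 2 - x ^+ 2).
  apply: (@le_trans _ _ ((m ^+ 2 - x ^+ 2) * (x + 1 - m))); first by nra.
  by rewrite ler_wpM2r ?(ltW D0)//; nra.
apply: (@le_trans _ _ ((m ^+ 2 - x ^+ 2) / 4 * (x + 1 - m))).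
  by rewrite -subr_ge0; nra.
by rewrite ler_wpM2r ?(ltW D0)//; nra.
Qed.

(** [p] and [pe] are the probabilities of crossing [a] and [e]. The left side without [dissip] is
    the expected value of [lyap] after one step, in which [S] becomes [S + 1]. *)
Lemma lyap_drift th k S A w p pe : 0 <= th -> th <= 1 -> 0 < k -> k <= 1 / 2 ->
  1 <= A -> A <= S -> 0 <= w -> w <= S -> 0 <= p -> pe <= 1 ->
  A <= p * (S - k * (1 - A / S) ^+ 2 * S) ->
  th * (pe * (w + A)) <= th * w ->
  th * ((w + pe) / (S + 1)) +
    36 / k * ((S + 1) * (p / (A + k / 8) + (1 - p) / (A - 1 + k / 8)) - 1) +
    8 * (36 / k) / (S + 1) + dissip th k S A w / S <= lyap th k S A w.
Proof.
move=> th0 th1 k0 k2 A1 AS w0 wS p0 pe1 hp hpe.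
have S1 : 1 <= S by lra.
have := phi_drift k0 k2 A1 AS p0 hp.
have f1 : 1 <= phi k S A by apply: phi_ge1 => //; lra.
rewrite /lyap /dissip; set q := A - 1 + k / 8.
set D := (S + 1) * _; set m := 1 - A / S; set x := w / S => hD.
have m0 : 0 <= m by rewrite /m subr_ge0 ler_pdivrMr; lra.
have x0 : 0 <= x by apply: divr_ge0; lra.
have x1 : x <= 1 by rewrite /x ler_pdivrMr; lra.
have q0 : 0 < q by rewrite /q; lra.
have L0 : 0 < 36 / k by apply: divr_gt0; lra.
have xE : w = S * x by rewrite /x; field; lra.
have AE : A = S * (1 - m) by rewrite /m; field; lra.
have hx : th * (pe - x) <= th * (8 * m ^+ 2 - x ^+ 2 / 4).
  have [->|thn0] := eqVneq th 0; first by rewrite !mul0r.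
  have thp : 0 < th by rewrite lt_neqAle eq_sym thn0.
  rewrite ler_pM2l//; apply: ratio_drift => //.
  move: hpe; rewrite ler_pM2l// => hpe.
  have wA : w + A = S * (x + 1 - m) by rewrite xE AE; ring.
  have S0 : 0 < S by lra.
  by rewrite -(ler_pM2l S0) mulrCA -wA -xE.
have {}hD := ler_wpM2l (ltW L0) hD.
have gE : 36 / k * (phi k S A - k / 4 * m ^+ 2 / q + 4 / S ^+ 2) =
    36 / k * phi k S A - 9 * (m ^+ 2 * phi k S A) / S + 4 * (36 / k) / S ^+ 2.
  by rewrite /phi -/q; field; repeat (apply/andP; split); lra.
rewrite gE in hD.
have h3 : th * ((w + pe) / (S + 1)) - th * x = th * (pe - x) / (S + 1).
  by rewrite xE; field; lra.
set g := m ^+ 2 * phi k S A in hD *; have g0 : m ^+ 2 <= g.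
  by rewrite /g ler_peMr// sqr_ge0.
have g00 : 0 <= g by apply: le_trans g0; exact: sqr_ge0.
(* Replacing [S + 1] by [S] costs at most a factor [2] on the negative term, since [S >= 1]. *)
have h4 : th * (pe - x) / (S + 1) <= 8 * g / S - th * x ^+ 2 / 8 / S.
  rewrite ler_pdivrMr; last by lra.
  have -> : (8 * g / S - th * x ^+ 2 / 8 / S) * (S + 1) =
    8 * g + 8 * g / S - th * x ^+ 2 / 8 - th * x ^+ 2 / 8 / S by field; lra.
  have t0 : 0 <= th * x ^+ 2 by apply: mulr_ge0 => //; exact: sqr_ge0.
  have gS : 0 <= g / S by apply: divr_ge0; lra.
  have tS : th * x ^+ 2 / S <= th * x ^+ 2 by rewrite ler_pdivrMr; nra.
  have tm : th * m ^+ 2 <= g by have := sqr_ge0 m; nra.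
  by lra.
(* The decrease of [8 * (36 / k) / S] over one step is of order [1 / S ^+ 2] and covers the error
   term. *)
have h5 : 8 * (36 / k) / (S + 1) + 4 * (36 / k) / S ^+ 2 <= 8 * (36 / k) / S.
  have -> : 8 * (36 / k) / S = 8 * (36 / k) / (S + 1) + 8 * (36 / k) / (S * (S + 1)).
    by field; repeat (apply/andP; split); lra.
  rewrite lerD2l -subr_ge0.
  have -> : 8 * (36 / k) / (S * (S + 1)) - 4 * (36 / k) / S ^+ 2 =
      4 * (36 / k) * (S - 1) / (S ^+ 2 * (S + 1)).
    by field; repeat (apply/andP; split); lra.
  by apply: divr_ge0; [apply: mulr_ge0|apply: mulr_ge0; [exact: sqr_ge0|]]; lra.
rewrite mulrBr mulrDl.
by lra.
Qed.

(** Shows that the drift cannot be small, for large [S], unless [lyap] itself is small. The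
    allowance [d] is split into [d / 4] for the term in [w], [d / 4] for the term in [phi] and
    [d / 2] for what is of order [1 / S]. *)
Lemma lyap_coercive k d : 0 < k -> k <= 1 -> 0 < d ->
  exists C S0 : R, [/\ 0 < C, 0 < S0 & forall th S A w, 0 <= th -> th <= 1 ->
    S0 <= S -> 1 <= A -> A <= S -> 0 <= w -> w <= S ->
    lyap th k S A w <= C * dissip th k S A w + d].
Proof.
move=> k0 k1 d0; pose L := 36 / k; pose eps := k / 8.
have L0 : 0 < L by apply: divr_gt0; lra.
have eps0 : 0 < eps by rewrite /eps; lra.
(* Chosen so that [L * (2 / eps) * e = d / 4]. *)
pose e := d * eps / (8 * L); have e0 : 0 < e by apply: divr_gt0; [nra|lra].
(* The three constants serve the term in [w], the case [m >= 1 / 2] and the case [m < 1 / 2]; the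
   threshold makes the terms in [1 / S] at most [d / 2]. *)
exists (32 / d + 4 * L + 2 * L / (eps * e)), ((2 * L / eps + 8 * L) * 2 / d).
have c1 : 0 < 32 / d by apply: divr_gt0; lra.
have c2 : 0 < 2 * L / (eps * e) by apply: divr_gt0; [lra|exact: mulr_gt0].
have c3 : 0 < 2 * L / eps by apply: divr_gt0; lra.
split; [lra|by apply: divr_gt0; lra|].
move=> th S A w th0 th1 SS A1 AS w0 wS; have S0 : 0 < S by lra.
have f1 := phi_ge1 k0 k1 A1 AS.
rewrite /lyap /dissip -/L; set m := 1 - A / S; set x := w / S; set f := phi k S A in f1 *.
have m0 : 0 <= m by rewrite /m subr_ge0 ler_pdivrMr; lra.
have m1 : m <= 1 by rewrite /m gerBl; apply: divr_ge0; lra.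
have x0 : 0 <= x by apply: divr_ge0; lra.
have AE : A = S * (1 - m) by rewrite /m; field; lra.
have thx0 : 0 <= th * x ^+ 2 by apply: mulr_ge0 => //; exact: sqr_ge0.
have mf0 : m ^+ 2 <= m ^+ 2 * f by rewrite ler_peMr// sqr_ge0.
have mf00 : 0 <= m ^+ 2 * f by apply: le_trans mf0; exact: sqr_ge0.
have young (c y : R) : 0 < c -> y <= c + y ^+ 2 / c.
  move=> c0; rewrite -(ler_pM2r c0) mulrDl mulfVK ?gt_eqF//.
  by have := sqr_ge0 (y - c); have := sqr_ge0 (y + c); nra.
have h1 : th * x <= d / 4 + 32 / d * (th * x ^+ 2 / 8).
  have := young (d / 4) x ltac:(lra); have -> : x ^+ 2 / (d / 4) = 4 / d * x ^+ 2.
    by field; lra.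
  move=> /(ler_wpM2l th0); rewrite mulrDr.
  have : th * (d / 4) <= d / 4 by nra.
  have -> : 32 / d * (th * x ^+ 2 / 8) = th * (4 / d * x ^+ 2) by field; lra.
  by lra.
have h2 : (2 * L / eps + 8 * L) / S <= d / 2.
  rewrite ler_pdivrMr//; move: SS; rewrite ler_pdivrMr//; lra.
have h3 : L * (f - 1) <= (4 * L + 2 * L / (eps * e)) * (m ^+ 2 * f) + d / 4 +
    2 * L / eps / S.
  have c4 : 0 < 2 * L / eps / S by apply: divr_gt0.
  have [m2|m2] := leP (1 / 2) m.
    have m4 : 1 <= 4 * m ^+ 2 by nra.
    have ff : f <= 4 * (m ^+ 2 * f) by rewrite mulrA ler_peMl//; lra.
    have : L * f <= L * (4 * (m ^+ 2 * f)) by rewrite ler_wpM2l// ltW.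
    have : 0 <= 2 * L / (eps * e) * (m ^+ 2 * f) by apply: mulr_ge0 => //; exact: ltW.
    by lra.
  have q0 : 0 < A - 1 + eps by lra.
  have f2 : f <= 2 / eps.
    rewrite /f /phi ler_pdivrMr// mulrAC ler_pdivlMr//.
    rewrite -/eps; have : eps * A <= A - 1 + eps by rewrite /eps; nra.
    have : S <= 2 * A by rewrite AE; nra.
    nra.
  (* As [f] is bounded when [m < 1 / 2], [f - 1] is linear in [m] up to [1 / S], and [young] turns
     [m] into [m ^+ 2]. *)
  have fE : f - 1 = f * (m + (1 - eps) / S).
    by rewrite /f /phi /m -/eps; field; apply/andP; split; lra.
  have mS : m + (1 - eps) / S <= e + m ^+ 2 / e + 1 / S.
    rewrite lerD ?young// ler_pM2r ?invr_gt0//; lra.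
  have mS0 : 0 <= m + (1 - eps) / S.
    by apply: addr_ge0 => //; apply: divr_ge0; rewrite /eps; lra.
  have : f - 1 <= 2 / eps * (e + m ^+ 2 / e + 1 / S).
    by rewrite fE; apply: ler_pM => //; lra.
  move=> /(ler_wpM2l (ltW L0)).
  have -> : L * (2 / eps * (e + m ^+ 2 / e + 1 / S)) =
    d / 4 + 2 * L / (eps * e) * m ^+ 2 + 2 * L / eps / S.
    by rewrite /e; field; repeat (apply/andP; split); lra.
  by nra.
have h4 : 2 * L / eps / S = (2 * L / eps + 8 * L) / S - 8 * L / S.
  by field; apply/andP; split; lra.
have : 0 <= 32 / d * (m ^+ 2 * f) by apply: mulr_ge0; lra.
have : 0 <= (4 * L + 2 * L / (eps * e)) * (th * x ^+ 2 / 8) by apply: mulr_ge0; lra.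
by lra.
Qed.

End Lyapunov.

(** * Lower bounds and one-step update of the Lyapunov function *)

Section LyapunovBounds.
Context {R : realFieldType}.
Implicit Types (S A w p pe k th b c : R).

Lemma dissip_ge0 th k S A w : 0 <= th -> 0 < k -> k <= 1 -> 1 <= A -> A <= S ->
  0 <= dissip th k S A w.
Proof.
move=> th0 k0 k1 A1 AS; have f1 := phi_ge1 k0 k1 A1 AS.
rewrite /dissip; apply: addr_ge0; last by apply: mulr_ge0; [exact: sqr_ge0|lra].
by apply: divr_ge0; [apply: mulr_ge0 => //; exact: sqr_ge0|lra].
Qed.

(** These bounds convert the convergence of [lyap] to [0] into that of [A / S] to [1] and, for
    [th = 1], of [w / S] to [0]. The first one uses [phi k S A >= S / A >= 2 - A / S]. *)
Lemma lyap_lower th k S A w : 0 <= th -> 0 < k -> k <= 1 -> 1 <= A -> A <= S ->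
  0 <= w -> 1 - A / S <= lyap th k S A w /\ th * (w / S) <= lyap th k S A w.
Proof.
move=> th0 k0 k1 A1 AS w0; have f1 := phi_ge1 k0 k1 A1 AS.
have S0 : 0 < S by lra.
have L1 : 1 <= 36 / k by rewrite ler_pdivlMr//; lra.
have x0 : 0 <= th * (w / S) by rewrite mulr_ge0// divr_ge0//; lra.
have z0 : 0 <= 8 * (36 / k) / S by rewrite divr_ge0 ?mulr_ge0//; lra.
have AS0 : 0 < A / S by rewrite divr_gt0//; lra.
have y0 : phi k S A - 1 <= 36 / k * (phi k S A - 1) by rewrite ler_peMl//; lra.
have AS1 : A / S <= 1 by rewrite ler_pdivrMr; lra.
have hf : 2 - A / S <= phi k S A.
  rewrite /phi ler_pdivlMr; last by lra.
  apply: (@le_trans _ _ ((2 - A / S) * A)); first by rewrite ler_wpM2l; lra.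
  rewrite [X in _ * X <= _](_ : A = S * (A / S)); last by field; lra.
  rewrite mulrCA -[leRHS]mulr1 ler_pM2l//.
  by have := sqr_ge0 (1 - A / S); lra.
by rewrite /lyap; split; lra.
Qed.

Lemma lyap_ge0 th k S A w : 0 <= th -> 0 < k -> k <= 1 -> 1 <= A -> A <= S ->
  0 <= w -> 0 <= lyap th k S A w.
Proof.
move=> th0 k0 k1 A1 AS w0; have [+ _] := lyap_lower th0 k0 k1 A1 AS w0.
by apply: le_trans; rewrite subr_ge0 ler_pdivrMr; lra.
Qed.

(** The excess of [lyap] at total [S + 1] when [A] stays the same over its value when [A] grows by
    [1]. *)
Definition lyap_coef k S A := 36 / k * ((S + 1) * ((A - 1 + k / 8)^-1 - (A + k / 8)^-1)).

Lemma lyap_coef_ge0 k S A : 0 < k -> 1 <= A -> A <= S -> 0 <= lyap_coef k S A.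
Proof.
move=> k0 A1 AS; rewrite /lyap_coef mulr_ge0 ?divr_ge0//; [lra|].
by rewrite mulr_ge0//; [lra|rewrite subr_ge0 lef_pV2 ?posrE; lra].
Qed.

(** The next value is affine in the indicators of crossing [e] and of not crossing [a], with
    nonnegative coefficients for these two when [th] is nonnegative; so its integral only involves
    the masses of these events. *)
Lemma lyap_update th k S A w (b c : bool) : 0 < k -> 1 <= A -> A <= S ->
  lyap th k (S + 1) (A + b%:R) (w + c%:R) =
  lyap th k (S + 1) (A + 1) w + th / (S + 1) * c%:R + lyap_coef k S A * (~~ b)%:R.
Proof.
move=> k0 A1 AS; rewrite /lyap /lyap_coef /phi.
by case: b; case: c => /=; field; repeat (apply/andP; split); lra.
Qed.

Lemma lyap_step th k S A w p pe : 0 < k -> 1 <= A -> A <= S ->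
  lyap th k (S + 1) (A + 1) w + th / (S + 1) * pe + lyap_coef k S A * (1 - p) =
  th * ((w + pe) / (S + 1)) +
    36 / k * ((S + 1) * (p / (A + k / 8) + (1 - p) / (A - 1 + k / 8)) - 1) +
    8 * (36 / k) / (S + 1).
Proof.
move=> k0 A1 AS; rewrite /lyap /lyap_coef /phi.
by field; repeat (apply/andP; split); lra.
Qed.

(* [h] is the mass of an event and [hp], [he] those of its intersections with
   two others. *)
Lemma lyap_drift_mass th k S A w h hp he : 0 <= th -> th <= 1 -> 0 < k -> k <= 1 / 2 ->
  1 <= A -> A <= S -> 0 <= w -> w <= S -> 0 <= hp -> hp <= h -> 0 <= he -> he <= h ->
  (0 < h -> A * h <= hp * (S - k * (1 - A / S) ^+ 2 * S)) ->
  th * (he * (w + A)) <= th * (h * w) ->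
  lyap th k (S + 1) (A + 1) w * h + th / (S + 1) * he + lyap_coef k S A * (h - hp) +
    dissip th k S A w / S * h <= lyap th k S A w * h.
Proof.
move=> th0 th1 k0 k2 A1 AS w0 wS hp0 hph he0 heh Ahp heA.
(* On a null event every term vanishes; otherwise [hp / h] and [he / h] are conditional
   probabilities. *)
have [h0|h0] := eqVneq h 0.
  have -> : hp = 0 by lra.
  have -> : he = 0 by lra.
  by rewrite h0 subrr !mulr0 !addr0.
have hgt0 : 0 < h by rewrite lt_neqAle eq_sym h0; lra.
have p0 : 0 <= hp / h by rewrite divr_ge0//; lra.
have pe1 : he / h <= 1 by rewrite ler_pdivrMr// mul1r.
have c1 : A <= hp / h * (S - k * (1 - A / S) ^+ 2 * S).
  by rewrite mulrAC ler_pdivlMr//; exact: Ahp.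
have c2 : th * (he / h * (w + A)) <= th * w.
  by rewrite mulrAC mulrA ler_pdivrMr// -mulrA [w * h]mulrC.
have := lyap_drift th0 th1 k0 k2 A1 AS w0 wS p0 pe1 c1 c2.
rewrite -lyap_step//; set U := lyap _ _ _ _ _; set C := lyap_coef _ _ _.
set V := dissip _ _ _ _ _ => hU; have := ler_wpM2r (ltW hgt0) hU.
have -> // : (U + th / (S + 1) * (he / h) + C * (1 - hp / h) + V / S) * h =
  U * h + th / (S + 1) * he + C * (h - hp) + V / S * h.
by field; repeat (apply/andP; split); lra.
Qed.

End LyapunovBounds.

(** * Nonnegative supermartingales with coercive drift *)

Lemma shifted_harmonic_unbounded {R : realType} (m : nat) (B : R) :
  exists n, B < \sum_(i < n) (i + m).+1%:R^-1.
Proof.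
apply: contrapT => /forallNP h.
have {}h n : \sum_(i < n) (i + m).+1%:R^-1 <= B by rewrite leNgt; apply/negP/h.
apply: (@dvg_harmonic R); apply: nondecreasing_is_cvgn.
  by apply: nondecreasing_series => n _ _; exact: ltW (harmonic_gt0 n).
exists (series harmonic m + B) => _ [n _ <-].
apply: (@le_trans _ _ (series harmonic (m + n)%N)).
  apply: nondecreasing_series; last exact: leq_addl.
  by move=> k _ _; exact: ltW (harmonic_gt0 k).
rewrite /series/= (big_cat_nat (n := m))//= ?leq_addr//.
rewrite lerD2l -{1}[m]add0n big_addn addKn big_mkord.
exact: h.
Qed.

Section Supermartingale.
Context {R : realType} {d : measure_display} {T : measurableType d}.
Variables (P : probability T R) (F : nat -> set (set T)).
Hypothesis F_measurable : forall n A, F n A -> measurable A.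
Hypothesis F_setT : forall n, F n setT.
Hypothesis F_setI : forall n A B, F n A -> F n B -> F n (A `&` B).
Hypothesis F_mono : forall n A, F n A -> F n.+1 A.
Variables Y V : nat -> T -> R.
Hypothesis Y_ge0 : forall n t, 0 <= Y n t.
Hypothesis V_ge0 : forall n t, 0 <= V n t.
Hypothesis mY : forall n, measurable_fun setT (Y n).
Hypothesis mV : forall n, measurable_fun setT (V n).
Hypothesis Y_adapted : forall n r, F n [set t | Y n t < r].
Variable s : nat.
Hypothesis Y0_fin : (\int[P]_t (Y 0 t)%:E < +oo)%E.
(** The supermartingale property with drift, integrated over the events of [F n] instead of stated
    with conditional expectations. *)
Hypothesis drift : forall n A, F n A ->
  (\int[P]_(t in A) (Y n.+1 t)%:E + \int[P]_(t in A) (V n t / (n + s).+1%:R)%:E <=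
   \int[P]_(t in A) (Y n t)%:E)%E.

Local Notation EY n := (\int[P]_t (Y n t)%:E)%E.

Let mYE n A : measurable A -> measurable_fun A (EFin \o Y n).
Proof. by move=> mA; apply/measurable_EFinP; exact: measurable_funS (mY n). Qed.

Let mVE n A : measurable A -> measurable_fun A (EFin \o V n).
Proof. by move=> mA; apply/measurable_EFinP; exact: measurable_funS (mV n). Qed.

Let iY_ge0 n A : (0 <= \int[P]_(t in A) (Y n t)%:E)%E.
Proof. by apply: integral_ge0 => t _; rewrite lee_fin. Qed.

Let iV_ge0 n A : (0 <= \int[P]_(t in A) (V n t / (n + s).+1%:R)%:E)%E.
Proof. by apply: integral_ge0 => t _; rewrite lee_fin divr_ge0. Qed.

Lemma supermartingale_le n A : F n A ->
  (\int[P]_(t in A) (Y n.+1 t)%:E <= \int[P]_(t in A) (Y n t)%:E)%E.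
Proof. by move=> FA; apply: le_trans (drift FA); rewrite leeDl. Qed.

Lemma supermartingale_fin n : (EY n < +oo)%E.
Proof.
elim: n => // n; apply: le_lt_trans; exact/supermartingale_le.
Qed.

(** Doob's inequality, by stopping at the first time the level [e] is reached. *)
Lemma maximal_inequality_finite (e : R) (j K : nat) : 0 < e ->
  (e%:E * P [set t | exists2 i, (i < K)%N & (e <= Y (j + i) t)%R] <= EY j)%E.
Proof.
move=> e0; pose A k := [set t | forall i, (i < k)%N -> Y (j + i) t < e].
pose B k := [set t | exists2 i, (i < k)%N & e <= Y (j + i) t].
have AS k : A k.+1 = A k `&` [set t | Y (j + k) t < e].
  apply/seteqP; split=> [t h|t [h1 h2] i] /=.
    by split=> [i ik|]; apply: h => //; rewrite ltnS ltnW.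
  by rewrite ltnS leq_eqVlt => /predU1P[->//|]; exact: h1.
have FA k : F (j + k) (A k).
  elim: k => [|k IH]; last by rewrite AS addnS; apply/F_mono/F_setI.
  rewrite (_ : A 0 = setT)//; apply/seteqP; split=> // t _ i; by rewrite ltn0.
have mA k : measurable (A k) := F_measurable (FA k).
have BS k : B k.+1 = B k `|` (A k `\` [set t | Y (j + k) t < e]).
  apply/seteqP; split=> [t [i ik ei]|t [[i ik ei]|[h /negP]]] /=.
  - have [[i' ik' ei']|nB] := pselect (B k t); first by left; exists i'.
    right; split=> [i' ik'|]; first by rewrite ltNge; apply/negP => ?; apply: nB; exists i'.
    move: ik ei; rewrite ltnS leq_eqVlt => /predU1P[->|ik ei].
      by move=> ei; apply/negP; rewrite -leNgt.
    by exfalso; apply: nB; exists i.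
  - by exists i => //; rewrite ltnS ltnW.
  - by rewrite -leNgt => ?; exists k.
have mB k : measurable (B k).
  have -> : B k = ~` A k.
    apply/seteqP; split=> [t [i ik ei] /(_ i ik)|t /existsNP[i /not_implyP[ik /negP]]].
      by rewrite ltNge ei.
    by rewrite -leNgt => ei; exists i.
  exact: measurableC.
rewrite -/(B K).
(* Keeping the integral over [A K], where the level is not yet reached, makes the induction on [K]
   work. *)
suff : (e%:E * P (B K) + \int[P]_(t in A K) (Y (j + K) t)%:E <= EY j)%E.
  by apply: le_trans; rewrite leeDl.
elim: K => [|k IH].
  rewrite (_ : B 0 = set0) ?measure0 ?mule0 ?add0e ?addn0; last first.
    by apply/seteqP; split => // t [i]; rewrite ltn0.
  by apply: ge0_subset_integral => //; [exact: mYE|move=> t _; rewrite lee_fin].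
apply: le_trans IH.
have mD : measurable (A k `\` [set t | Y (j + k) t < e]).
  by apply: measurableD => //; exact: F_measurable (Y_adapted _ _).
rewrite BS measureU//; last first.
  by apply/seteqP; split => // t [[i ik ei] [/(_ i ik)]]; rewrite ltNge ei.
(* Either [Y] stays below [e] at time [j + k] as well, or it reaches [e] there for the first
   time. *)
have iA : (\int[P]_(t in A k) (Y (j + k) t)%:E =
   \int[P]_(t in A k.+1) (Y (j + k) t)%:E +
   \int[P]_(t in A k `\` [set t | (Y (j + k) t < e)%R]) (Y (j + k) t)%:E)%E.
  rewrite -ge0_integral_setU//.
  - by rewrite AS setUIDK.
  - by rewrite AS setUIDK; exact: mYE.
  - by move=> t _; rewrite lee_fin.
  - by rewrite AS; apply/disj_setPS => t [[_ ?] [_ ?]].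
rewrite iA muleDr ?ge0_adde_def ?inE// -addeA leeD2l// addeC leeD//.
  by rewrite addnS; apply: supermartingale_le; rewrite AS; apply: F_setI.
rewrite -integral_cst//; apply: ge0_le_integral => //.
- by move=> t _; rewrite lee_fin ltW.
- exact: mYE.
- by move=> t [_ /negP]; rewrite -leNgt lee_fin.
Qed.

Lemma maximal_inequality (e : R) (j : nat) : 0 < e ->
  (e%:E * P [set t | exists i, (e <= Y (j + i) t)%R] <= EY j)%E.
Proof.
move=> e0; pose B k := [set t | exists2 i, (i < k)%N & e <= Y (j + i) t].
have mB k : measurable (B k).
  rewrite (_ : B k = \bigcup_(i in [set i | (i < k)%N]) ~` [set t | Y (j + i) t < e]).
    apply: bigcup_measurable => i _; apply: measurableC.
    exact: F_measurable (Y_adapted _ _).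
  apply/seteqP; split=> [t [i ik ei]|t [i ik /negP]]; first by exists i => //=; rewrite ltNge ei.
  by rewrite -leNgt; exists i.
have -> : [set t | exists i, e <= Y (j + i) t] = \bigcup_k B k.
  apply/seteqP; split=> [t [i ei]|t [k _ [i ik ei]]]; last by exists i.
  by exists i.+1 => //; exists i.
have cB : (P \o B) n @[n --> \oo] --> P (\bigcup_k B k).
  apply: nondecreasing_cvg_mu => //; first exact: bigcup_measurable.
  move=> m n mn; apply/subsetPset => t [i im ei]; exists i => //.
  exact: leq_trans mn.
rewrite -(cvg_lim _ cB)// -limeMl//; last by apply/cvg_ex; exists (P (\bigcup_k B k)).
apply: lime_le; first by apply: is_cvgeMl => //; apply/cvg_ex; exists (P (\bigcup_k B k)).
by near=> n; exact: maximal_inequality_finite.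
Unshelve. all: by end_near. Qed.

Hypothesis coercive : forall e, 0 < e -> exists C n0, 0 < C /\
  forall n t, (n0 <= n)%N -> Y n t <= C * V n t + e.

(** Otherwise coercivity keeps the expectation of [V] away from [0], and the accumulated drift, a
    divergent harmonic sum, exceeds the finite initial expectation. *)
Lemma inf_expectation (e : R) : 0 < e -> exists n, (EY n < e%:E)%E.
Proof.
move=> e0; apply: contrapT => /forallNP h.
have {}h n : (e%:E <= EY n)%E by rewrite leNgt; apply/negP/h.
have [C [n0 [C0 YV]]] := coercive (divr_gt0 e0 (ltr0Sn R 1)).
pose c := e / 2 / C; have c0 : 0 < c by rewrite !divr_gt0.
(* From [Y n <= C * V n + e / 2] and an expectation of [Y n] at least [e], that of [V n] is at least
   [c]. *)
have iV n : (n0 <= n)%N -> ((c / (n + s).+1%:R)%:E <=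
    \int[P]_t (V n t / (n + s).+1%:R)%:E)%E.
  move=> n0n; have hV : (e%:E <= C%:E * \int[P]_t (V n t)%:E + (e / 2)%:E)%E.
    apply: (le_trans (h n)).
    have -> : (e / 2)%:E = (\int[P]_t (e / 2)%:E)%E.
      by rewrite integral_cst// [X in (_ * X)%E](probability_setT P) mule1.
    rewrite -ge0_integralZl//; last 3 first.
    - exact: mVE.
    - by move=> t _; rewrite lee_fin.
    - by rewrite ltW.
    rewrite -ge0_integralD//; last 3 first.
    - by move=> t _; rewrite mule_ge0// lee_fin// ltW.
    - by apply: measurable_funeM; exact: mVE.
    - by move=> t _; rewrite lee_fin divr_ge0// ltW.
    apply: ge0_le_integral => //.
    - by move=> t _; rewrite lee_fin.
    - exact: mYE.
    - by apply: emeasurable_funD => //; apply: measurable_funeM; exact: mVE.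
    - by move=> t _; rewrite -EFinM -EFinD lee_fin YV.
  under eq_integral do rewrite mulrC EFinM.
  rewrite ge0_integralZl//; last 2 first.
  - exact: mVE.
  - by move=> t _; rewrite lee_fin.
  rewrite mulrC EFinM lee_wpmul2l//.
  have : (0 <= \int[P]_t (V n t)%:E)%E by apply: integral_ge0 => t _; rewrite lee_fin.
  move: hV; case: (\int[P]_t (V n t)%:E)%E => [r| |]//; rewrite ?leey//.
  rewrite -EFinM -EFinD !lee_fin => hV r0.
  by rewrite /c ler_pdivrMr//; lra.
have dec n : ((\sum_(i < n) c / (i + (n0 + s)).+1%:R)%:E + EY (n0 + n) <= EY n0)%E.
  elim: n => [|n IH]; first by rewrite big_ord0 add0e addn0.
  apply: le_trans IH; rewrite big_ord_recr/= EFinD -addeA leeD2l//.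
  apply: le_trans (drift (F_setT (n0 + n))).
  rewrite addnS addeC leeD2l//; have := iV (n0 + n)%N (leq_addr _ _).
  by rewrite addnA [(n + n0)%N]addnC.
have yfin : EY n0 \is a fin_num by rewrite ge0_fin_numE// supermartingale_fin.
have [n] := shifted_harmonic_unbounded (n0 + s) (fine (EY n0) / c).
rewrite ltr_pdivrMr// mulr_suml => hn.
have := dec n; rewrite leNgt => /negP; apply.
apply: (@lt_le_trans _ _ ((\sum_(i < n) c / (i + (n0 + s)).+1%:R)%:E)%E); last by rewrite leeDl.
rewrite -(fineK yfin) lte_fin; under eq_bigr do rewrite mulrC.
exact: hn.
Qed.

Lemma supermartingale_cvg0 : {ae P, forall t, Y n t @[n --> \oo] --> (0 : R)}.
Proof.
have mE (e : R) j : measurable [set t | exists i, e <= Y (j + i) t].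
  rewrite (_ : mkset _ = \bigcup_i ~` [set t | Y (j + i) t < e]).
    apply: bigcup_measurable => i _; apply: measurableC.
    exact: F_measurable (Y_adapted _ _).
  apply/seteqP; split=> [t [i ei]|t [i _ /negP]]; first by exists i => //=; rewrite ltNge ei.
  by rewrite -leNgt; exists i.
have ae_k (k : nat) : {ae P, forall t, exists j, forall i, Y (j + i) t < k.+1%:R^-1}.
  pose e : R := k.+1%:R^-1; have e0 : 0 < e by rewrite invr_gt0.
  (* The exceptional event is that [Y] reaches [e] after every time [j]. Its probability is at most
     the expectation of [Y j] divided by [e], for every [j], and these expectations have infimum
     [0]. *)
  exists (\bigcap_j [set t | exists i, e <= Y (j + i) t]); split.
  - by apply: bigcap_measurable => //; exists 0.
  - apply/eqP; rewrite eq_le measure_ge0 andbT; apply/lee_addgt0Pr => z z0.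
    rewrite add0e; have [j hj] := inf_expectation (mulr_gt0 e0 z0).
    apply: (@le_trans _ _ (P [set t | exists i, e <= Y (j + i) t])).
      apply: le_measure; rewrite ?inE//; first by apply: bigcap_measurable => //; exists 0.
      exact: bigcap_inf.
    have := le_trans (maximal_inequality j e0) (ltW hj).
    by rewrite EFinM lee_pmul2l.
  - move=> t nt j _ /=; apply: contrapT => /forallNP h; apply: nt; exists j => i.
    by rewrite ltNge; apply/negP/h.
have /ae_foralln := ae_k; apply: filterS => t ht.
apply/cvgrPdist_lt => e e0.
have [k _ ke] := near_infty_natSinv_lt (PosNum e0).
have [j hj] := ht k.
near=> n; rewrite sub0r normrN ger0_norm//.
apply: (@lt_trans _ _ k.+1%:R^-1); last exact: (ke k (leqnn k)).
by rewrite -(@subnKC j n)//; near: n; exists j.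
Unshelve. all: by end_near. Qed.

End Supermartingale.

(** * Discrete random variables *)

Section DiscreteVariables.
Context {d : measure_display} {T : measurableType d}.

(** For countably valued maps, measurable fibres are all that is required, and no sigma-algebra on
    the target has to be chosen. *)
Definition discrete (I : choiceType) (f : T -> I) :=
  forall i, measurable [set t | f t = i].

Lemma discreteP (I : countType) (f : T -> I) (Q : I -> Prop) :
  discrete f -> measurable [set t | Q (f t)].
Proof.
move=> mf; have -> : [set t | Q (f t)] =
    \bigcup_(i : I) (if `[< Q i >] then [set t | f t = i] else set0).
  apply/seteqP; split=> [t Qt|t [i _]]; first by exists (f t) => //; case: asboolP.
  by case: asboolP => // Qi /= ->.
apply: countable_bigcupT_measurable; first exact: countableP.
by move=> i; case: ifP.
Qed.

Lemma discrete_comp (I : countType) (J : choiceType) (f : T -> I) (g : I -> J) :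
  discrete f -> discrete (g \o f).
Proof. by move=> mf j; exact: (discreteP (fun i => g i = j) mf). Qed.

Lemma discrete_pair (I J : choiceType) (f : T -> I) (g : T -> J) :
  discrete f -> discrete g -> discrete (fun t => (f t, g t)).
Proof.
move=> mf mg [i j]; rewrite (_ : mkset _ = [set t | f t = i] `&` [set t | g t = j]).
  exact: measurableI.
by apply/seteqP; split=> [t [<- <-]|t [/= -> ->]].
Qed.

Lemma discrete_mkseq (I : countType) (f : nat -> T -> I) k :
  (forall j, discrete (f j)) -> discrete (fun t => mkseq (f ^~ t) k).
Proof.
move=> mf; elim: k => [|k IH].
  move=> s; have [->|s0] := eqVneq s [::].
    by rewrite (_ : mkset _ = setT)//; apply/seteqP.
  rewrite (_ : mkset _ = set0)//; apply/seteqP; split => // t /= h.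
  by rewrite -h in s0.
rewrite (_ : (fun t => _) = (fun z => rcons z.1 z.2) \o
   (fun t => (mkseq (f ^~ t) k, f k t))).
  by apply: discrete_comp; exact: discrete_pair.
by apply/funext => t; rewrite mkseqS.
Qed.

Lemma measurable_fun_discrete (d' : measure_display) (U : measurableType d')
    (I : countType) (f : T -> I) (g : I -> U) :
  discrete f -> measurable_fun setT (g \o f).
Proof.
move=> mf _ A mA; rewrite setTI; exact: (discreteP (fun i => A (g i)) mf).
Qed.

Lemma measurable_and (Q Q' : T -> Prop) : measurable [set t | Q t] ->
  measurable [set t | Q' t] -> measurable [set t | Q t /\ Q' t].
Proof. exact: measurableI. Qed.

Lemma measurable_or (Q Q' : T -> Prop) : measurable [set t | Q t] ->
  measurable [set t | Q' t] -> measurable [set t | Q t \/ Q' t].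
Proof. exact: measurableU. Qed.

Lemma measurable_not (Q : T -> Prop) :
  measurable [set t | Q t] -> measurable [set t | ~ Q t].
Proof. by move=> mQ; exact: (measurableC mQ). Qed.

Lemma measurable_ex (I : countType) (Q : I -> T -> Prop) :
  (forall i, measurable [set t | Q i t]) -> measurable [set t | exists i, Q i t].
Proof.
move=> mQ; rewrite (_ : mkset _ = \bigcup_i [set t | Q i t]).
  by apply: countable_bigcupT_measurable; first exact: countableP.
by apply/seteqP; split=> [t [i ?]|t [i _ ?]]; exists i.
Qed.

Lemma measurable_forall (I : countType) (Q : I -> T -> Prop) :
  (forall i, measurable [set t | Q i t]) -> measurable [set t | forall i, Q i t].
Proof.
move=> mQ; rewrite (_ : mkset _ = ~` [set t | exists i, ~ Q i t]).
  by apply: measurableC; apply: measurable_ex => i; exact: measurable_not.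
apply/seteqP; split=> [t Qt [i]|t nQ i]; first exact.
by apply: contrapT => Qi; apply: nQ; exists i.
Qed.

End DiscreteVariables.

(** * Masses of events inside a fixed event *)

Section Probability.
Context {R : realType} {d : measure_display} {T : measurableType d}.
Variables (P : probability T R) (B : set T).
Hypothesis mB : measurable B.

(** The mass is not divided by that of [B], so a null [B] raises no difficulty. *)
Definition pr (Q : T -> Prop) : R := fine (P (B `&` [set t | Q t])).

Lemma pr_ge0 Q : 0 <= pr Q.
Proof. exact/fine_ge0/measure_ge0. Qed.

Lemma prE Q : measurable [set t | Q t] -> (pr Q)%:E = P (B `&` [set t | Q t]).
Proof. by move=> mQ; rewrite fineK// fin_num_measure//; exact: measurableI. Qed.

Lemma pr_le Q Q' : measurable [set t | Q t] -> measurable [set t | Q' t] ->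
  (forall t, B t -> Q t -> Q' t) -> pr Q <= pr Q'.
Proof.
move=> mQ mQ' QQ'; rewrite -lee_fin !prE//; apply: le_measure.
- by rewrite inE; exact: measurableI.
- by rewrite inE; exact: measurableI.
- by move=> t [Bt Qt]; split => //; exact: QQ'.
Qed.

Lemma pr_eq Q Q' : (forall t, B t -> Q t <-> Q' t) -> pr Q = pr Q'.
Proof.
move=> QQ'; rewrite /pr; congr (fine (P _)); apply/seteqP.
by split=> t [Bt Qt]; split=> //; exact/QQ'.
Qed.

Lemma pr_False Q : (forall t, B t -> ~ Q t) -> pr Q = 0.
Proof.
move=> nQ; rewrite /pr (_ : _ `&` _ = set0) ?measure0//.
by apply/seteqP; split=> // t [/nQ].
Qed.

Lemma pr_or Q Q' : measurable [set t | Q t] -> measurable [set t | Q' t] ->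
  (forall t, B t -> Q t -> ~ Q' t) -> pr (fun t => Q t \/ Q' t) = pr Q + pr Q'.
Proof.
move=> mQ mQ' QQ'; apply: EFin_inj; rewrite EFinD !prE//; last exact: measurable_or.
rewrite -measureU; [by rewrite -setIUr|exact: measurableI|exact: measurableI|].
by apply/seteqP; split => // t [[Bt /(QQ' _ Bt) nQ] [_]].
Qed.

Lemma pr_or_le Q Q' : measurable [set t | Q t] -> measurable [set t | Q' t] ->
  pr (fun t => Q t \/ Q' t) <= pr Q + pr Q'.
Proof.
move=> mQ mQ'; have mnQ := measurable_not mQ.
have mD : measurable [set t | Q' t /\ ~ Q t] by exact: measurable_and.
have -> : pr (fun t => Q t \/ Q' t) = pr (fun t => Q t \/ (Q' t /\ ~ Q t)).
  by apply: pr_eq => t _; have [] := pselect (Q t); tauto.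
rewrite pr_or//; last by move=> t _ Qt [].
by rewrite lerD2l pr_le// => t _ [].
Qed.

Lemma pr_not Q : measurable [set t | Q t] ->
  pr (fun t => ~ Q t) = pr (fun=> True) - pr Q.
Proof.
move=> mQ; have mnQ := measurable_not mQ.
apply/eqP; rewrite eq_sym subr_eq addrC -pr_or//; last by move=> t _ ? [].
by apply/eqP/pr_eq => t _; have [] := pselect (Q t); tauto.
Qed.

Lemma measurable_mem_ex (I : eqType) (s : seq I) (Q : I -> T -> Prop) :
  (forall i, measurable [set t | Q i t]) ->
  measurable [set t | exists2 i, i \in s & Q i t].
Proof.
move=> mQ; elim: s => [|i s IH].
  by rewrite (_ : mkset _ = set0)//; apply/seteqP; split=> // t [].
rewrite (_ : mkset _ = [set t | Q i t \/ exists2 i, i \in s & Q i t]).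
  exact: measurable_or.
apply/seteqP; split=> [t [j]|t [Qi|[j js Qj]]].
- by rewrite inE => /predU1P[->|js] Qj; [left|right; exists j].
- by exists i; rewrite ?inE ?eqxx.
- by exists j; rewrite // inE js orbT.
Qed.

Let ex_cons (I : eqType) i (s : seq I) (Q : I -> T -> Prop) t :
  (exists2 j, j \in i :: s & Q j t) <-> (Q i t \/ exists2 j, j \in s & Q j t).
Proof.
split=> [[j]|[Qi|[j js Qj]]].
- by rewrite inE => /predU1P[->|js] Qj; [left|right; exists j].
- by exists i; rewrite ?inE ?eqxx.
- by exists j; rewrite // inE js orbT.
Qed.

Lemma pr_sum (I : eqType) (s : seq I) (Q : I -> T -> Prop) : uniq s ->
  (forall i, measurable [set t | Q i t]) ->
  (forall i j t, B t -> Q i t -> Q j t -> i = j) ->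
  pr (fun t => exists2 i, i \in s & Q i t) = \sum_(i <- s) pr (Q i).
Proof.
move=> + mQ Qij; elim: s => [_|i s IH /andP[si us]].
  by rewrite big_nil pr_False// => t _ [].
rewrite big_cons -IH// -pr_or//; last 2 first.
- exact: measurable_mem_ex.
- by move=> t Bt Qi [j js Qj]; move: si; rewrite (Qij _ _ _ Bt Qi Qj) js.
by apply: pr_eq => t _; exact: ex_cons.
Qed.

Lemma pr_sum_le (I : eqType) (s : seq I) (Q : I -> T -> Prop) :
  (forall i, measurable [set t | Q i t]) ->
  pr (fun t => exists2 i, i \in s & Q i t) <= \sum_(i <- s) pr (Q i).
Proof.
move=> mQ; elim: s => [|i s IH].
  by rewrite big_nil pr_False// => t _ [].
rewrite big_cons (le_trans _ (lerD (lexx _) IH))//.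
rewrite (le_trans _ (pr_or_le _ _))//; last exact: measurable_mem_ex.
by rewrite (pr_eq (fun t _ => ex_cons i s Q t)).
Qed.

Lemma pr_partition (I : finType) (f : T -> I) (Q : T -> Prop) : discrete f ->
  measurable [set t | Q t] -> pr Q = \sum_i pr (fun t => Q t /\ f t = i).
Proof.
move=> mf mQ; rewrite -pr_sum ?index_enum_uniq//.
- apply: pr_eq => t _; split=> [Qt|[i _ []//]].
  by exists (f t); rewrite ?mem_index_enum.
- by move=> i; exact: measurable_and.
- by move=> i j t _ [_ <-] [].
Qed.

End Probability.

(** * Crossing probabilities for fixed weights *)

(** Stands for the limit in [K] of bounds whose error is at most [c / K]. *)
Lemma mulr_natr_bounded_le0 {R : realType} (r c : R) :
  (forall K : nat, r * K%:R <= c) -> r <= 0.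
Proof.
move=> rc; rewrite leNgt; apply/negP => r0.
have := archi_boundP (normr_ge0 (c / r)); set K := Num.bound _ => cK.
have := rc K; rewrite leNgt => /negP; apply.
by rewrite mulrC -ltr_pdivrMr// (le_lt_trans (ler_norm _) cK).
Qed.

Section WalkLaw.
Context {R : realType} {d : measure_display} {T : measurableType d}.
Variables (P : probability T R) (G : multigraph) (N F : vertex G) (a : edge G).
Variables (B : set T) (y : nat -> T -> option (edge G)) (w : edge G -> nat).
Hypothesis NF : N != F.
Hypothesis aE : ends a = [set N; F]%SET.
Hypothesis a_uniq : forall e : edge G, ends e = [set N; F]%SET -> e = a.
Hypothesis mB : measurable B.
Hypothesis y_discrete : forall k, discrete (y k).
Hypothesis y_legal : forall t, B t -> legal_walk N F (y ^~ t).
Hypothesis w_gt0 : forall e, (0 < w e)%N.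
Hypothesis y_markov : forall s o,
  P (B `&` [set t | mkseq (y ^~ t) (size s) = s] `&` [set t | y (size s) t = o]) =
  (P (B `&` [set t | mkseq (y ^~ t) (size s) = s]) *
   (move_prob R F w (position N s) o)%:E)%E.

Local Notation hist k t := (mkseq (y ^~ t) k).
Local Notation at_ k v := (fun t => pos N (y ^~ t) k = v).
Local Notation pr := (pr P B).
Local Notation total v := (\sum_(e : edge G | v \in ends e) (w e)%:R : R).
Local Notation h := (pr (fun=> True)).

Let m_hist k (Q : seq (option (edge G)) -> Prop) : measurable [set t | Q (hist k t)].
Proof. exact: discreteP (discrete_mkseq _ y_discrete). Qed.

Let m_at k v : measurable [set t | pos N (y ^~ t) k = v].
Proof. exact: (m_hist k (fun s => position N s = v)). Qed.

Let m_y k o : measurable [set t | y k t = o].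
Proof. exact: y_discrete. Qed.

Let m_not_food k : measurable [set t | pos N (y ^~ t) k <> F].
Proof. exact: (measurable_not (m_at k F)). Qed.

Let m_crossed e : measurable [set t | exists k, y k t = Some e].
Proof. exact: measurable_ex. Qed.

(** Sums [y_markov] over the finitely many histories of length [k] that satisfy [C] and end at
    [v]. *)
Lemma pr_move (C : seq (option (edge G)) -> Prop) k v o :
  pr (fun t => (C (hist k t) /\ pos N (y ^~ t) k = v) /\ y k t = o) =
  pr (fun t => C (hist k t) /\ pos N (y ^~ t) k = v) * move_prob R F w v o.
Proof.
have mCv : measurable [set t | C (hist k t) /\ pos N (y ^~ t) k = v].
  exact: measurable_and.
(* As a tuple of fixed length, the history takes values in a finite type. *)
pose f t := [tuple of mkseq (y ^~ t) k].
have fE t (s : k.-tuple (option (edge G))) : f t = s <-> hist k t = s.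
  by split=> [<-//|ts]; apply: val_inj.
have mf : discrete f.
  move=> s; rewrite (_ : mkset _ = [set t | hist k t = s]).
    exact: (m_hist k (fun u => u = s)).
  by apply/seteqP; split=> t /fE.
have E s : pr (fun t => ((C (hist k t) /\ pos N (y ^~ t) k = v) /\ y k t = o) /\ f t = s) =
    pr (fun t => (C (hist k t) /\ pos N (y ^~ t) k = v) /\ f t = s) * move_prob R F w v o.
  have [[Cs sv]|nCs] := pselect (C s /\ position N s = v); last first.
    have none t : (C (hist k t) /\ pos N (y ^~ t) k = v) /\ f t = s -> False.
      by move=> [[Ct tv] /fE ts]; apply: nCs; rewrite -ts.
    rewrite [in LHS]pr_False => [|t _ [[Ct _] ts]]; last exact: (none t).
    by rewrite pr_False ?mul0r// => t _; exact: none.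
  have -> : pr (fun t => ((C (hist k t) /\ pos N (y ^~ t) k = v) /\ y k t = o) /\ f t = s) =
      pr (fun t => hist k t = s /\ y k t = o).
    apply: pr_eq => t _; split=> [[[_ yo] /fE]//|[ts yo]].
    by split; [rewrite /pos ts; tauto|exact/fE].
  have -> : pr (fun t => (C (hist k t) /\ pos N (y ^~ t) k = v) /\ f t = s) =
      pr (fun t => hist k t = s).
    apply: pr_eq => t _; split=> [[_ /fE]//|ts].
    by split; [rewrite /pos ts; tauto|exact/fE].
  have ms : measurable [set t | hist k t = s] := m_hist k (fun u => u = s).
  apply: EFin_inj; rewrite EFinM !prE//; last exact: measurable_and.
  have := y_markov s o; rewrite size_tuple sv => <-; congr (P _).
  by apply/seteqP; split=> t [] // => [Bt []|[Bt]].
rewrite (pr_partition P mB mf); last exact: measurable_and.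
by rewrite (pr_partition P mB mf)// mulr_suml; apply: eq_bigr => s _; exact: E.
Qed.

Lemma pr_cross k v e : v != F -> v \in ends e ->
  pr (fun t => pos N (y ^~ t) k = v /\ y k t = Some e) =
  (w e)%:R * (pr (at_ k v) / total v).
Proof.
move=> vF ve; have -> : pr (fun t => pos N (y ^~ t) k = v /\ y k t = Some e) =
    pr (fun t => (True /\ pos N (y ^~ t) k = v) /\ y k t = Some e).
  by apply: pr_eq => t _; tauto.
rewrite (pr_move (fun=> True)) /move_prob vF ve/=.
have -> : pr (fun t => True /\ pos N (y ^~ t) k = v) = pr (at_ k v).
  by apply: pr_eq => t _; tauto.
by rewrite mulrCA.
Qed.

Let w_ge0 e : 0 <= (w e)%:R :> R.
Proof. exact: ler0n. Qed.

Lemma total_ge_w v e : v \in ends e -> (w e)%:R <= total v.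
Proof. by move=> ve; rewrite (bigD1 e)//= lerDl sumr_ge0. Qed.

Lemma total_gt0 v e : v \in ends e -> 0 < total v.
Proof. by move=> /total_ge_w; apply: lt_le_trans; rewrite ltr0n. Qed.

Let Na : N \in ends a. Proof. by rewrite aE !inE eqxx. Qed.
Let Fa : F \in ends a. Proof. by rewrite aE !inE eqxx orbT. Qed.

(** The last edge crossed before reaching [z] joins it to [cross z e], and it avoids [F] because the
    walk never leaves [F]. Dividing the mass at a vertex by its total weight makes the coefficient
    of [e] the same in both directions: this is reversibility. *)
Lemma pr_pos_rec k z : z != F ->
  pr (at_ k.+1 z) = \sum_(e : edge G | (z \in ends e) && (F \notin ends e))
    (w e)%:R * (pr (at_ k (cross z e)) / total (cross z e)).
Proof.
move=> zF; pose D e t := pos N (y ^~ t) k = cross z e /\ y k t = Some e.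
transitivity (\sum_(e : edge G | (z \in ends e) && (F \notin ends e)) pr (D e)).
  rewrite -big_filter -pr_sum//.
  - apply: pr_eq => t Bt; rewrite posS; split=> [|[e]].
      have := y_legal Bt k; rewrite /legal/=; case yk: (y k t) => [e|]/=; last first.
        by move=> /eqP -> Fz; rewrite Fz eqxx in zF.
      move=> /andP[pF pe] cz; have ze : z \in ends e by rewrite -cz mem_cross.
      exists e; last by split=> //; rewrite -cz crossK.
      rewrite mem_filter mem_index_enum andbT ze/=.
      have [-> _] := ends_crossE pe; rewrite cz !inE negb_or.
      by rewrite ![F == _]eq_sym pF.
    rewrite mem_filter => /andP[/andP[ze _] _] [-> yk].
    by rewrite /= yk /= crossK.
  - by rewrite filter_uniq// index_enum_uniq.
  - by move=> e; exact: measurable_and.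
  - by move=> e e' t _ [_ yk] [_]; rewrite yk => -[].
apply: eq_bigr => e /andP[ze Fe]; rewrite -pr_cross//; last exact: mem_cross.
by apply: contra Fe => /eqP <-; exact: mem_cross.
Qed.

(** For an isolated [v] the quotient is a division by [0], but then the walk is never at [v] and
    both sides vanish. *)
Lemma pr_at_total k v : v != F -> pr (at_ k v) = total v * (pr (at_ k v) / total v).
Proof.
move=> vF; have [[e ve]|nv] := pselect (exists e, v \in ends e).
  by rewrite mulrCA divff ?mulr1// gt_eqF// (total_gt0 ve).
have nve e : v \notin ends e by apply/negP => ve; apply: nv; exists e.
have -> : total v = 0 by rewrite big_pred0// => e; exact/negbTE/nve.
rewrite mul0r; case: k => [|k].
  by apply: pr_False => t _; rewrite /pos/= /position/= => Nv; have := nve a; rewrite -Nv Na.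
by rewrite pr_pos_rec// big_pred0// => e; rewrite (negbTE (nve e)).
Qed.

(* By reversibility [green K v] is, up to the factor [total N], the expected
   number of visits to [N] before time [K] of the walk started at [v]; the bound
   by [green K N] is obtained here directly from the recursion. *)
Definition green K v : R := \sum_(0 <= k < K) pr (at_ k v) / total v.

Let div_ge0 k v : 0 <= pr (at_ k v) / total v.
Proof. by rewrite divr_ge0 ?pr_ge0// sumr_ge0. Qed.

Lemma green_ge0 K v : 0 <= green K v.
Proof. by apply: sumr_ge0. Qed.

Lemma green_leS K v : green K v <= green K.+1 v.
Proof. by rewrite /green [leRHS]big_nat_recr//= lerDl. Qed.

Lemma green_rec K z : z != F -> z != N ->
  total z * green K.+1 z =
  \sum_(e : edge G | (z \in ends e) && (F \notin ends e))
    (w e)%:R * green K (cross z e).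
Proof.
move=> zF zN; rewrite /green mulr_sumr.
under eq_bigr do rewrite -pr_at_total//.
rewrite big_nat_recl//= pr_False ?add0r; last first.
  by move=> t _; rewrite /pos/= /position/= => Nz; rewrite Nz eqxx in zN.
under eq_bigr do rewrite pr_pos_rec//.
by rewrite exchange_big/=; apply: eq_bigr => e _; rewrite mulr_sumr.
Qed.

Lemma green_le_rec K z : z != F -> z != N ->
  (forall v, v != F -> green K v <= green K N) ->
  total z * green K.+1 z <=
  (\sum_(e : edge G | (z \in ends e) && (F \notin ends e)) (w e)%:R) * green K N.
Proof.
move=> zF zN gN; rewrite green_rec// mulr_suml; apply: ler_sum => e /andP[ze Fe].
rewrite ler_wpM2l// gN//; apply: contra Fe => /eqP <-; exact: mem_cross.
Qed.

(** Maximum principle: away from [N] and [F], [green_rec] bounds [green K.+1] by a combination of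
    values of [green K] with coefficients of sum at most [1]. *)
Lemma green_le_nest K v : v != F -> green K v <= green K N.
Proof.
elim: K v => [|K IH] v vF; first by rewrite /green !big_geq.
have [->//|vN] := eqVneq v N.
have [[e ve]|nv] := pselect (exists e, v \in ends e); last first.
  rewrite [leLHS](_ : _ = 0) ?green_ge0// /green big1// => k _.
  have -> : total v = 0.
    by rewrite big_pred0// => e; apply/negP => ve; apply: nv; exists e.
  by rewrite invr0 mulr0.
have := green_le_rec vF vN IH => /le_trans h1.
rewrite -(ler_pM2l (total_gt0 ve)); apply: h1.
apply: ler_pM; rewrite ?sumr_ge0 ?green_ge0 ?green_leS//.
rewrite [leRHS](bigID (fun e => F \notin ends e))/= lerDl sumr_ge0//.
Qed.

(** Sharpens [green_le_nest] at a neighbour of [F]: the edge [f] is missing from the recursion, so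
    the remaining coefficients add up to at most [1 - w f / total (cross F f)]. *)
Lemma green_food K f : F \in ends f -> cross F f != N ->
  green K (cross F f) <= (1 - (w f)%:R / total (cross F f)) * green K N.
Proof.
move=> Ff; set v := cross F f => vN.
have vf : v \in ends f by exact: mem_cross.
have vF : v != F by exact: cross_neq.
have t0 := total_gt0 vf.
have wt : 0 <= 1 - (w f)%:R / total v by rewrite subr_ge0 ler_pdivrMr// mul1r total_ge_w.
case: K => [|K]; first by rewrite /green !big_geq// mulr0.
rewrite -(ler_pM2l t0); apply: le_trans (green_le_rec vF vN (green_le_nest K)) _.
rewrite mulrA mulrBr mulr1 [total v * (_ / _)]mulrCA divff ?gt_eqF// mulr1.
apply: ler_pM; rewrite ?sumr_ge0 ?green_ge0 ?green_leS//.
rewrite [X in _ <= X - _](bigID (fun e => F \notin ends e))/= -addrA lerDl.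
by rewrite subr_ge0 (bigD1 f) ?vf ?Ff//= lerDl sumr_ge0.
Qed.

Lemma pr_food k f : F \in ends f ->
  pr (fun t => y k t = Some f) =
  (w f)%:R * (pr (at_ k (cross F f)) / total (cross F f)).
Proof.
move=> Ff; rewrite -pr_cross ?cross_neq ?mem_cross//.
apply: pr_eq => t Bt; split=> [yk|[]//]; split=> //.
by have := y_legal Bt k; rewrite yk => /andP[pF pf]; rewrite (cross_eq Ff pf).
Qed.

(** An edge at [F] can only be crossed from its other endpoint, so its weight times [green] there
    accounts for arrivals at [F] through it before time [K]. *)
Lemma green_food_sum K f : F \in ends f ->
  (w f)%:R * green K (cross F f) = \sum_(0 <= k < K) pr (fun t => y k t = Some f).
Proof.
by move=> Ff; rewrite mulr_sumr; apply: eq_bigr => k _; rewrite pr_food.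
Qed.

Lemma green_food_le K f : F \in ends f ->
  (w f)%:R * green K (cross F f) <= pr (fun t => exists k, y k t = Some f).
Proof.
move=> Ff; rewrite green_food_sum// -pr_sum ?iota_uniq//.
- apply: pr_le => //; first by apply: measurable_mem_ex.
  by move=> t _ [k _ yk]; exists k.
- move=> i j t Bt yi yj; apply/eqP; rewrite eqn_leq.
  by rewrite (food_last (y_legal Bt) yi Ff yj) (food_last (y_legal Bt) yj Ff yi).
Qed.

Let crossFa : cross F a = N.
Proof. by apply: cross_eq => //. Qed.

Lemma green_nest_le K : (w a)%:R * green K N <= h.
Proof.
have := green_food_le K Fa; rewrite crossFa => /le_trans; apply.
by apply: pr_le => //; exact: measurableT.
Qed.

(** A walk that is at [F] at time [K] has arrived there through some edge at [F]. *)
Lemma pr_absorbed K : h - pr (fun t => pos N (y ^~ t) K <> F) <=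
  \sum_(f : edge G | F \in ends f) (w f)%:R * green K (cross F f).
Proof.
rewrite pr_not// subKr; under eq_bigr do rewrite green_food_sum//.
pose D f t := exists2 k, k \in index_iota 0 K & y k t = Some f.
have mD f : measurable [set t | D f t] by exact: measurable_mem_ex.
apply: (@le_trans _ _ (pr (fun t =>
  exists2 f, f \in [seq f <- index_enum _ | F \in ends f] & D f t))).
  apply: pr_le => //; first exact: measurable_mem_ex.
  move=> t Bt /(pos_food_edge (y_legal Bt) NF)[j [f [jK yj Ff]]].
  exists f; first by rewrite mem_filter Ff mem_index_enum.
  by exists j => //; rewrite mem_index_iota.
apply: le_trans (pr_sum_le P mB _ mD) _.
rewrite big_filter; apply: ler_sum => f _; exact: pr_sum_le.
Qed.

(** * Time to reach the food and bounds on the crossing probabilities *)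

Variable q : R.
Hypothesis total_le : forall v, total v <= q.

(** The mass of walks not yet at [F] decreases with [K], so [K] times it is at most the expected
    time spent outside [F]. Each vertex contributes [total v * green K v] to that time, which is
    bounded through [green_le_nest] and [green_nest_le]. *)
Lemma pr_not_food_bounded : exists2 c : R, 0 <= c &
  forall K : nat, pr (fun t => pos N (y ^~ t) K <> F) * K%:R <= c.
Proof.
have q0 : 0 <= q by apply: le_trans (total_le N); rewrite sumr_ge0.
have wa0 : 0 < (w a)%:R :> R by rewrite ltr0n.
exists (\sum_(v : vertex G) q * (h / (w a)%:R)).
  by apply: sumr_ge0 => v _; rewrite mulr_ge0// divr_ge0// pr_ge0.
move=> K; have -> : pr (fun t => pos N (y ^~ t) K <> F) * K%:R =
    \sum_(0 <= k < K) pr (fun t => pos N (y ^~ t) K <> F).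
  by rewrite big_const_nat subn0 iter_addr addr0 mulr_natr.
apply: (@le_trans _ _ (\sum_(0 <= k < K) \sum_(v | v != F) pr (at_ k v))).
  rewrite big_nat_cond [leRHS]big_nat_cond; apply: ler_sum => k /andP[/andP[_ kK] _].
  rewrite -big_filter; apply: le_trans (pr_sum_le P mB _ (m_at k)).
  apply: pr_le => //; first exact: measurable_mem_ex.
  move=> t Bt pK; exists (pos N (y ^~ t) k) => //.
  rewrite mem_filter mem_index_enum andbT; apply/eqP => pk; apply: pK.
  by have [] := absorbed (y_legal Bt) (ltnW kK) pk.
rewrite exchange_big/= big_mkcond/=; apply: ler_sum => v _.
case: ifPn => vF; last by rewrite mulr_ge0// divr_ge0// pr_ge0.
under eq_bigr do rewrite pr_at_total//.
rewrite -mulr_sumr -/(green K v) ler_pM ?sumr_ge0 ?green_ge0//.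
apply: le_trans (green_le_nest _ vF) _.
by rewrite ler_pdivlMr// mulrC green_nest_le.
Qed.

(** Arrivals through [a] have mass [w a * green K N], and by [green_food] those through [f] at most
    [w f * (1 - w f / q) * green K N]. Up to the walks that are still not at [F], these masses add
    up to [h]. *)
Lemma pr_crossed_lower :
  h * (w a)%:R <= ((w a)%:R + \sum_(f : edge G | (F \in ends f) && (f != a))
    (w f)%:R * (1 - (w f)%:R / q)) * pr (fun t => exists k, y k t = Some a).
Proof.
set D := _ + _; set p := pr (fun t => exists k, _); have wa0 : 0 < (w a)%:R :> R by rewrite ltr0n.
have q0 : 0 < q by apply: lt_le_trans (total_le N); exact: total_gt0 Na.
have D0 : 0 < D.
  rewrite /D ltr_wpDr// sumr_ge0// => f /andP[Ff _]; rewrite mulr_ge0// subr_ge0.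
  by rewrite ler_pdivrMr// mul1r (le_trans (total_ge_w Ff)).
have [c c0 hc] := pr_not_food_bounded.
rewrite -subr_le0; apply: (mulr_natr_bounded_le0 (c := (w a)%:R * c)) => K.
have step1 : (h - pr (fun t => pos N (y ^~ t) K <> F)) <= D * green K N.
  apply: le_trans (pr_absorbed K) _.
  rewrite (bigD1 a)//= crossFa /D mulrDl lerD2l mulr_suml.
  apply: ler_sum => f /andP[Ff fa]; rewrite -mulrA ler_wpM2l//.
  have vN : cross F f != N.
    apply: contra fa => /eqP fN; apply/eqP/a_uniq.
    by have [-> _] := ends_crossE Ff; rewrite fN finset.setUC.
  apply: le_trans (green_food K Ff vN) _; rewrite ler_wpM2r ?green_ge0//.
  rewrite lerD2l lerN2 ler_wpM2l// lef_pV2 ?posrE//.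
  by apply: total_gt0; exact: mem_cross Ff.
have step2 : (w a)%:R * green K N <= p by have := green_food_le K Fa; rewrite crossFa.
have step3 : (w a)%:R * (h - pr (fun t => pos N (y ^~ t) K <> F)) <= D * p.
  apply: le_trans (ler_wpM2l (ltW wa0) step1) _.
  by rewrite mulrCA ler_pM2l.
apply: (@le_trans _ _ ((w a)%:R * (pr (fun t => pos N (y ^~ t) K <> F) * K%:R))).
  by rewrite mulrA ler_wpM2r// lerBlDr -lerBlDl; move: step3; lra.
by rewrite ler_pM2l.
Qed.

(** By [first_crossing], [e] is first crossed from [N]. At each visit to [N] before that, [e] and
    [a] are chosen in the proportion of their weights, and either choice ends these visits. *)
Lemma pr_crossed_upper e : tree_like F -> N \in ends e -> e != a ->
  pr (fun t => exists k, y k t = Some e) * ((w e)%:R + (w a)%:R) <= h * (w e)%:R.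
Proof.
move=> tF Ne ea; have wea0 : 0 < (w e)%:R + (w a)%:R :> R by rewrite -natrD ltr0n addn_gt0 w_gt0.
have Fe : F \notin ends e.
  apply: contra ea => Fe; apply/eqP/a_uniq; have [-> _] := ends_crossE Ne.
  by rewrite (cross_eq Ne Fe)// eq_sym.
have [c c0 hc] := pr_not_food_bounded.
pose C k t := Some e \notin hist k t /\ pos N (y ^~ t) k = N.
have mC k : measurable [set t | C k t].
  exact: (m_hist k (fun s => Some e \notin s /\ position N s = N)).
pose S K := \sum_(0 <= k < K) pr (C k) / total N.
have sumS (b : edge G) K : N \in ends b ->
    \sum_(0 <= k < K) pr (fun t => C k t /\ y k t = Some b) = (w b)%:R * S K.
  move=> Nb; rewrite mulr_sumr; apply: eq_bigr => k _.
  by rewrite (pr_move (fun s => Some e \notin s)) /move_prob NF Nb/= mulrCA.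
have mCy k o : measurable [set t | C k t /\ y k t = o] by exact: measurable_and.
(* Crossing [e] or [a] from [C] happens at one step at most: after [e] the history contains it, and
   after [a] the walk stays at [F]. *)
have S_le K : S K * ((w e)%:R + (w a)%:R) <= h.
  rewrite mulrC mulrDl -!sumS// -big_split/=.
  under eq_bigr => k _.
    rewrite -pr_or//; last by move=> t _ [_ ->] [_ []]; exact/eqP.
    over.
  have mCC k : measurable [set t | (C k t /\ y k t = Some e) \/ (C k t /\ y k t = Some a)].
    exact: measurable_or.
  rewrite -pr_sum ?iota_uniq//.
    by apply: pr_le => //; [exact: measurable_mem_ex|exact: measurableT].
  suff lt i j t : B t -> y i t = Some e \/ y i t = Some a -> C j t -> (i < j)%N -> False.
    have CE i t : (C i t /\ y i t = Some e) \/ (C i t /\ y i t = Some a) ->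
        C i t /\ (y i t = Some e \/ y i t = Some a).
      by case=> -[Ci yi]; split=> //; [left|right].
    move=> i j t Bt /CE[Ci yi] /CE[Cj yj]; case: (ltngtP i j) => // ij.
      by case: (lt i j t Bt yi Cj ij).
    by case: (lt j i t Bt yj Ci ij).
  move=> Bt yi [nj pj] ij; case: yi => yi.
    by move/mapP: nj; apply; exists i; rewrite ?mem_iota.
  have [pF _] := absorbed (y_legal Bt) ij (pos_food (y_legal Bt) yi Fa).
  by move: NF; rewrite -pF pj eqxx.
(* If the first crossing of [e] occurs at time [K] or later, the walk is not at [F] at time [K]. *)
have le_S K : pr (fun t => exists k, y k t = Some e) <=
    (w e)%:R * S K + pr (fun t => pos N (y ^~ t) K <> F).
  rewrite -sumS//; have := pr_sum_le P mB (index_iota 0 K) (fun k => mCy k (Some e)).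
  rewrite -(lerD2r (pr (fun t => pos N (y ^~ t) K <> F))); apply: le_trans.
  have mQ := measurable_mem_ex (index_iota 0 K) (fun k => mCy k (Some e)).
  apply: le_trans (pr_or_le P mB mQ (m_not_food K)); apply: pr_le => //.
    exact: measurable_or.
  move=> t Bt [k yk]; have ex : exists k, y k t == Some e by exists k; apply/eqP.
  case: (ex_minnP ex) => m /eqP ym mmin.
  have [mK|Km] := ltnP m K; [left; exists m; rewrite ?mem_index_iota//|right].
    have ne j : (j < m)%N -> y j t != Some e.
      by move=> jm; apply/negP => /mmin; rewrite leqNgt jm.
    split=> //; split; last exact: (first_crossing (y_legal Bt) tF NF Ne Fe ne ym).
    apply/mapP => -[j]; rewrite mem_iota/= => jm ej.
    by have := ne j jm; rewrite -ej eqxx.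
  by move=> pK; have [_] := absorbed (y_legal Bt) Km pK; rewrite ym.
rewrite -subr_le0; apply: (mulr_natr_bounded_le0 (c := ((w e)%:R + (w a)%:R) * c)) => K.
apply: (@le_trans _ _ (((w e)%:R + (w a)%:R) * (pr (fun t => pos N (y ^~ t) K <> F) * K%:R))).
  rewrite mulrA ler_wpM2r//.
  have := ler_wpM2r (ltW wea0) (le_S K).
  have := ler_wpM2l (w_ge0 e) (S_le K); rewrite mulrDl -mulrA; lra.
by rewrite ler_pM2l.
Qed.

End WalkLaw.

(** * Measurability of the ant process *)

Section Weights.
Context {d : measure_display} {T : measurableType d} {G : multigraph}.
Variable X : nat -> nat -> T -> option (edge G).

(** As a finite function, the weight configuration lives in a countable type. *)
Definition weights n t : {ffun edge G -> nat} := [ffun e => weight X n t e].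

Lemma weights_eq n t (w : {ffun edge G -> nat}) :
  (weight X n t =1 w) <-> weights n t = w.
Proof.
by split=> [h|<- e]; [apply/ffunP => e; rewrite ffunE h|rewrite ffunE].
Qed.

Lemma mem_trace n t e : (e \in trace X n t) <-> exists k, X n k t = Some e.
Proof. by rewrite inE; split=> [/asboolP|h]//; exact/asboolP. Qed.

Lemma weightS n t e : weight X n.+1 t e = (weight X n t e + (e \in trace X n t))%N.
Proof. by []. Qed.

Lemma weight_ge1 n t e : (1 <= weight X n t e)%N.
Proof. by elim: n => //= n IH; rewrite (leq_trans IH)// leq_addr. Qed.

Lemma weight_le n t e : (weight X n t e <= n.+1)%N.
Proof.
elim: n => //= n IH; rewrite -addn1 leq_add//; exact: leq_b1.
Qed.

Lemma trace_discrete n : (forall k, discrete (X n k)) -> discrete (trace X n).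
Proof.
move=> mX A; rewrite (_ : mkset _ = [set t | forall e : edge G,
    if e \in A then exists k, X n k t = Some e else ~ exists k, X n k t = Some e]).
  apply: measurable_forall => e.
  have mE : measurable [set t | exists k, X n k t = Some e].
    by apply: measurable_ex => k; exact: mX.
  by case: (e \in A) => //; exact: measurable_not.
apply/seteqP; split=> [t <- e|t h].
  by case: ifPn => [/mem_trace//|/negP eA /mem_trace].
apply/setP => e; have := h e; case: ifPn => [eA /mem_trace//|eA nE].
by apply/negP => /mem_trace.
Qed.

(** Only walks before [n] appear in the hypothesis, so the lemma also applies with the past of [n]
    as sigma-algebra. *)
Lemma weights_discrete n : (forall m k, (m < n)%N -> discrete (X m k)) ->
  discrete (weights n).
Proof.
elim: n => [_|n IH mX].
  move=> w; have [->|w1] := eqVneq w [ffun=> 1%N].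
    by rewrite (_ : mkset _ = setT)//; apply/seteqP.
  rewrite (_ : mkset _ = set0)//; apply/seteqP; split => // t /= h.
  by rewrite -h in w1; case/eqP: w1; apply/ffunP => e; rewrite !ffunE.
have mW : discrete (weights n).
  by apply: IH => m k mn; apply: mX; rewrite ltnS ltnW.
have mT : discrete (trace X n) by apply: trace_discrete => k; exact: mX.
have -> : weights n.+1 = (fun z : {ffun edge G -> nat} * {set edge G} =>
    [ffun e => (z.1 e + (e \in z.2))%N]) \o (fun t => (weights n t, trace X n t)).
  by apply/funext => t; apply/ffunP => e; rewrite !ffunE.
by apply: discrete_comp; exact: discrete_pair.
Qed.

End Weights.

Section Past.
Context {d : measure_display} {T : measurableType d} {G : multigraph}.
Variable X : nat -> nat -> T -> option (edge G).
Hypothesis X_discrete : forall n k, discrete (X n k).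

Lemma past_measurable n A : past X n A -> measurable A.
Proof.
apply: smallest_sub; first exact: sigma_algebra_measurable.
by move=> B [m [k [x [_ BE]]]]; rewrite BE; exact: X_discrete.
Qed.

(** The space [T] equipped with the sigma-algebra [past X n]. *)
Let pastT n := g_sigma_algebraType
  [set B | exists m k o, (m < n)%N /\ B = [set t | X m k t = o]].

Lemma past_setT n : past X n setT.
Proof. exact: (@measurableT _ (pastT n)). Qed.

Lemma past_setI n A B : past X n A -> past X n B -> past X n (A `&` B).
Proof. exact: (@measurableI _ (pastT n)). Qed.

Lemma past_mono n A : past X n A -> past X n.+1 A.
Proof.
apply: sub_sigma_algebra2 => B [m [k [x [mn BE]]]].
by exists m, k, x; rewrite ltnS ltnW.
Qed.

Lemma past_weights n (Q : {ffun edge G -> nat} -> Prop) :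
  past X n [set t | Q (weights X n t)].
Proof.
apply: (@discreteP _ (pastT n)); apply: (@weights_discrete _ (pastT n)) => m k mn o.
by apply: sub_sigma_algebra; exists m, k, o.
Qed.

End Past.

(** * Null events and almost sure legality of the moves *)

Section NullSets.
Context {R : realType} {d : measure_display} {T : measurableType d}.
Variable P : probability T R.

Lemma discrete_null (I : countType) (Z : T -> I) (Q : I -> Prop) : discrete Z ->
  (forall i, Q i -> P [set t | Z t = i] = 0%E) -> P [set t | Q (Z t)] = 0%E.
Proof.
move=> mZ Z0; apply/negligibleP; first exact: discreteP.
apply: (@negligibleS _ _ _ _ (\bigcup_n [set t | Q (Z t) /\ pickle (Z t) = n])).
  by move=> t Qt; exists (pickle (Z t)).
apply: negligible_bigcup => n.
have mn : measurable [set t | Q (Z t) /\ pickle (Z t) = n].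
  exact: (discreteP (fun i => Q i /\ pickle i = n) mZ).
apply/negligibleP => //; apply/eqP; rewrite eq_le measure_ge0 andbT.
have [[t [Qt tn]]|none] := pselect (exists t, Q (Z t) /\ pickle (Z t) = n).
  rewrite -(Z0 _ Qt); apply: le_measure; rewrite ?inE//.
  by move=> t' [_]; rewrite -tn => /(pcan_inj pickleK).
rewrite (_ : mkset _ = set0) ?measure0//.
by apply/seteqP; split => // t h; apply: none; exists t.
Qed.

Lemma measure_conull A B : measurable A -> measurable B -> P (~` B) = 0%E ->
  P (A `&` B) = P A.
Proof.
move=> mA mB B0; rewrite [RHS](measureDI P mA mB).
rewrite [X in (X + _)%E](_ : _ = 0%E) ?add0e//.
apply/eqP; rewrite eq_le measure_ge0 andbT -B0.
apply: le_measure; rewrite ?inE; [exact: measurableD|exact: measurableC|].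
by move=> t [].
Qed.

End NullSets.

Section Legality.
Context {R : realType} {d : measure_display} {T : measurableType d}.
Variables (P : probability T R) (G : multigraph) (N F : vertex G).
Variable X : nat -> nat -> T -> option (edge G).
Hypothesis antX : ant_process P N F X.

Let X_discrete n k : discrete (X n k).
Proof. by move=> o; have [+ _] := antX; apply. Qed.

Let W_discrete n : discrete (weights X n).
Proof. exact: weights_discrete. Qed.

Definition all_legal := [set t | forall n, legal_walk N F ((X n) ^~ t)].

Let step_discrete n k : discrete (fun t => (mkseq ((X n) ^~ t) k, X n k t)).
Proof. by apply: discrete_pair => //; exact: discrete_mkseq. Qed.

Let legal_step (z : seq (option (edge G)) * option (edge G)) :=
  legal F (position N z.1) z.2.

Lemma measurable_all_legal : measurable all_legal.
Proof.
apply: measurable_forall => n; apply: measurable_forall => k.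
exact: (discreteP legal_step (step_discrete n k)).
Qed.

(** For each of the countably many choices of weights, history and illegal move, [move_prob] is [0],
    and [ant_process] gives mass [0]. *)
Lemma all_legal_conull : P (~` all_legal) = 0%E.
Proof.
apply/negligibleP; first exact/measurableC/measurable_all_legal.
apply: (@negligibleS _ _ _ _ (\bigcup_n \bigcup_k
    [set t | ~ legal F (pos N ((X n) ^~ t) k) (X n k t)])).
  by move=> t /existsNP[n /existsNP[k h]]; exists n => //; exists k.
apply: negligible_bigcup => n; apply: negligible_bigcup => k.
apply/negligibleP.
  exact: (discreteP (fun z => ~ legal_step z) (step_discrete n k)).
apply: (@discrete_null _ _ _ P _ (fun t => (weights X n t, (mkseq ((X n) ^~ t) k, X n k t)))
  (fun z => ~ legal_step z.2)); first exact: discrete_pair.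
move=> [w [s o]] /negP no.
have [sk|sk] := eqVneq (size s) k; last first.
  rewrite (_ : mkset _ = set0) ?measure0//; apply/seteqP; split => // t [_ ts _].
  by rewrite -ts size_mkseq eqxx in sk.
have pT : past X n setT by exact: past_setT.
have [_ /(_ n setT w s o pT)/=] := antX.
rewrite (_ : move_prob R F w (position N s) o = 0) ?mule0; last first.
  rewrite /move_prob; case: o no => [e|]; rewrite /legal_step/=; last by move=> /negbTE->.
  by move=> /negbTE ->.
move=> h; rewrite -h; congr (P _); apply/seteqP; rewrite sk; split=> [t [<- <- <-]|].
  by split=> //; split=> //; split=> // e; rewrite ffunE.
by move=> t [[[_ /weights_eq/= ->] /= ->] ->].
Qed.

End Legality.

(** * The Lyapunov process *)

Section CauchySchwarz.
Context {R : realFieldType}.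

(** Applied to the weights [u] of the edges at [F] other than [a], with [z = S - A]. By
    Cauchy-Schwarz the sum of squares is at least the squared sum over [#|I|], and [z] then replaces
    the sum at the price of half the gain. *)
Lemma sum_dampened_le (I : finType) (Q : pred I) (u : I -> R) (S z k : R) :
  (forall i, 0 <= u i) -> \sum_(i | Q i) u i <= z -> z <= S -> 0 < S ->
  (0 < #|I|)%N -> k = (2 * #|I|%:R ^+ 2)^-1 ->
  \sum_(i | Q i) u i * (1 - u i / (#|I|%:R * S)) <= z - k * z ^+ 2 / S.
Proof.
move=> u0 Mz zS S0 I0 kE; set c : R := #|I|%:R in kE *; set M := \sum_(i | Q i) u i in Mz *.
have c1 : 1 <= c by rewrite ler1n.
have M0 : 0 <= M by rewrite sumr_ge0.
pose x := M / c; have x0 : 0 <= x by rewrite divr_ge0//; lra.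
have q0 : 0 < c * S by rewrite mulr_gt0//; lra.
have k0 : 0 < k by rewrite kE invr_gt0 mulr_gt0// exprn_gt0//; lra.
have k2 : k <= 1 / 2.
  by rewrite kE div1r lef_pV2 ?posrE ?mulr_gt0 ?exprn_gt0//; rewrite ?ler_peMr ?exprn_ege1//; lra.
(* Cauchy-Schwarz through the tangent of the square at [x]: [u i ^+ 2 >= 2 * x * u i - x ^+ 2]. *)
apply: (@le_trans _ _ (\sum_(i | Q i) (u i - (2 * x * u i - x ^+ 2) / (c * S)))).
  apply: ler_sum => i _; rewrite mulrBr mulr1 lerD2l lerN2 [leRHS]mulrA ler_pM2r ?invr_gt0//.
  by have := sqr_ge0 (u i - x); lra.
rewrite sumrB -/M -mulr_suml sumrB -mulr_sumr -/M sumr_const.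
have hc : x ^+ 2 *+ #|Q| <= x ^+ 2 * c.
  by rewrite -mulr_natr ler_wpM2l ?sqr_ge0// ler_nat max_card.
apply: (@le_trans _ _ (M - (2 * x * M - x ^+ 2 * c) / (c * S))).
  by rewrite lerD2l lerN2 ler_pM2r ?invr_gt0//; lra.
have -> : M - (2 * x * M - x ^+ 2 * c) / (c * S) = M - 2 * k * M ^+ 2 / S.
  by rewrite /x kE; field; apply/andP; split; lra.
rewrite -subr_ge0.
have -> : z - k * z ^+ 2 / S - (M - 2 * k * M ^+ 2 / S) =
  (z - M) * (1 - k * ((z + M) / S)) + k * M ^+ 2 / S by field; lra.
have zM : (z + M) / S <= 2 by rewrite ler_pdivrMr//; lra.
have zM0 : 0 <= (z + M) / S by rewrite divr_ge0//; lra.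
apply: addr_ge0; last by rewrite divr_ge0 ?mulr_ge0 ?sqr_ge0//; lra.
by apply: mulr_ge0; [lra|nra].
Qed.

End CauchySchwarz.

Section AffineIntegral.
Context {R : realType} {d : measure_display} {T : measurableType d}.
Variable P : probability T R.

Lemma integral_affine_indic (H E C : set T) (x b c : R) :
  measurable H -> measurable E -> measurable C -> 0 <= x -> 0 <= b -> 0 <= c ->
  (\int[P]_(t in H) (x + b * \1_E t + c * \1_C t)%:E =
   x%:E * P H + b%:E * P (H `&` E) + c%:E * P (H `&` C))%E.
Proof.
move=> mH mE mC x0 b0 c0.
have mi (D : set T) : measurable D -> measurable_fun H (fun t => (\1_D t : R)%:E).
  by move=> mD; apply/measurable_EFinP; exact: measurable_indic.
under eq_integral do rewrite !EFinD !EFinM.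
have ib (D : set T) (r : R) t : 0 <= r -> (0 <= r%:E * (\1_D t)%:E)%E.
  by move=> r0; rewrite mule_ge0// lee_fin.
rewrite ge0_integralD//; last 4 first.
- by move=> t _; rewrite adde_ge0 ?ib ?lee_fin.
- by apply: emeasurable_funD => //; apply: measurable_funeM; exact: mi.
- by move=> t _; rewrite ib.
- by apply: measurable_funeM; exact: mi.
rewrite ge0_integralD//; last 2 first.
- by move=> t _; rewrite ib.
- by apply: measurable_funeM; exact: mi.
rewrite integral_cst// !ge0_integralZl//.
- by rewrite !integral_indic// ![_ `&` H]setIC.
- exact: mi.
- exact: mi.
Qed.

End AffineIntegral.

Section Process.
Context {R : realType} {d : measure_display} {T : measurableType d}.
Variables (P : probability T R) (G : multigraph) (N F : vertex G) (a : edge G).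
Variable X : nat -> nat -> T -> option (edge G).
Hypothesis NF : N != F.
Hypothesis tF : tree_like F.
Hypothesis aE : ends a = [set N; F]%SET.
Hypothesis a_uniq : forall e : edge G, ends e = [set N; F]%SET -> e = a.
Hypothesis antX : ant_process P N F X.

Let Na : N \in ends a. Proof. by rewrite aE !inE eqxx. Qed.
Let Fa : F \in ends a. Proof. by rewrite aE !inE eqxx orbT. Qed.

Let X_discrete n k : discrete (X n k).
Proof. by move=> o; have [+ _] := antX; apply. Qed.

Let W_discrete n : discrete (weights X n).
Proof. exact: weights_discrete. Qed.

Let shift := #|[pred e : edge G | F \in ends e]|.-1.

(* [size_ n] is almost surely the total weight at time [n] of the edges at [F]. *)
Let size_ n : R := (n + shift).+1%:R.

(** The constant of [sum_dampened_le] for the type of edges. *)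
Let k : R := (2 * #|edge G|%:R ^+ 2)^-1.

Let edge_gt0 : (0 < #|edge G|)%N.
Proof. by apply/card_gt0P; exists a. Qed.

Let k_gt0 : 0 < k.
Proof. by rewrite invr_gt0 mulr_gt0// exprn_gt0// ltr0n. Qed.

Let k_le : k <= 1 / 2.
Proof.
by rewrite div1r lef_pV2 ?posrE ?mulr_gt0 ?exprn_gt0 ?ltr0n// ler_peMr// exprn_ege1// ler1n.
Qed.

Let k_le1 : k <= 1. Proof. by have := k_le; lra. Qed.

(** By [food_uniq] a legal walk reinforces at most one edge at [F]. *)
Lemma food_weight_le n t : all_legal N F X t ->
  (\sum_(f : edge G | F \in ends f) weight X n t f <= (n + shift).+1)%N.
Proof.
move=> lt; elim: n => [|n IH]; first by rewrite /= sum1_card leqSpred.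
under eq_bigr do rewrite weightS.
rewrite big_split/= addSn -addn1 leq_add//.
rewrite (_ : (\sum_(f | _) _)%N = #|[pred f | (F \in ends f) && (f \in trace X n t)]|); last first.
  by rewrite -sum1_card big_mkcondr/=; apply: eq_bigr => f _; case: (f \in _).
apply/card_le1_eqP => f f' /andP[Ff /mem_trace[i fi]] /andP[Ff' /mem_trace[j fj]].
exact: (food_uniq (lt n) fj Ff' fi Ff).
Qed.

(** * One step of the process on an event of the past with given weights *)

Section Step.
Variables (n : nat) (A : set T) (w : {ffun edge G -> nat}).
Hypothesis pA : past X n A.

(** The weights are constant on [H], so the results for fixed weights apply. Intersecting with the
    legal walks in [B] changes no mass and makes the pathwise arguments valid everywhere. *)
Let H := A `&` [set t | weights X n t = w].
Let B := H `&` all_legal N F X.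

Let mA : measurable A. Proof. exact: past_measurable pA. Qed.
Let mH : measurable H. Proof. by apply: measurableI => //; exact: W_discrete. Qed.
Let mB : measurable B.
Proof. by apply: measurableI => //; exact: (measurable_all_legal antX). Qed.

Let conull D : measurable D -> P (B `&` D) = P (H `&` D).
Proof.
move=> mD; rewrite /B setIAC; apply: measure_conull.
- exact: measurableI.
- exact: (measurable_all_legal antX).
- exact: (all_legal_conull antX).
Qed.

Let B_legal t : B t -> legal_walk N F ((X n) ^~ t).
Proof. by move=> [_]; apply. Qed.

Let B_markov s o :
  P (B `&` [set t | mkseq ((X n) ^~ t) (size s) = s] `&` [set t | X n (size s) t = o]) =
  (P (B `&` [set t | mkseq ((X n) ^~ t) (size s) = s]) *
   (move_prob R F w (position N s) o)%:E)%E.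
Proof.
have mh : measurable [set t | mkseq ((X n) ^~ t) (size s) = s].
  exact: (discrete_mkseq _ (X_discrete n)).
have mo : measurable [set t | X n (size s) t = o] by exact: X_discrete.
rewrite -setIA conull; last exact: measurableI.
rewrite conull//; have [_ /(_ n A w s o pA)/=] := antX.
have -> : [set t | weight X n t =1 w] = [set t | weights X n t = w].
  by apply/seteqP; split=> t /weights_eq.
by rewrite setIA.
Qed.

Local Notation pr := (pr P B).
Local Notation crossed e := (fun t => exists j, X n j t = Some e).

(** Feeds [pr_crossed_lower] and [pr_crossed_upper], with [q] equal to [#|edge G|] times [size_ n],
    into [lyap_drift_mass]. A point of [H] shows that [w] is an actual weight configuration, hence
    its bounds. *)
Lemma lyap_drift_event e (th := ((N \in ends e) && (e != a))%:R : R) :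
  H !=set0 ->
  lyap th k (size_ n + 1) ((w a)%:R + 1) (w e)%:R * pr (fun=> True) +
    th / (size_ n + 1) * pr (crossed e) +
    lyap_coef k (size_ n) (w a)%:R * (pr (fun=> True) - pr (crossed a)) +
    dissip th k (size_ n) (w a)%:R (w e)%:R / size_ n * pr (fun=> True) <=
  lyap th k (size_ n) (w a)%:R (w e)%:R * pr (fun=> True).
Proof.
move=> [t0 [_ wt0]].
have w1 b : (1 <= w b)%N by rewrite -wt0 ffunE weight_ge1.
have wn b : (w b <= n.+1)%N by rewrite -wt0 ffunE weight_le.
have wS b : (w b)%:R <= size_ n.
  by rewrite ler_nat (leq_trans (wn b))// ltnS leq_addr.
have mcr b : measurable [set t | exists j, X n j t = Some b].
  by apply: measurable_ex => j; exact: X_discrete.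
have pr_leT Q : measurable [set t | Q t] -> pr Q <= pr (fun=> True).
  by move=> mQ; apply: pr_le => //; exact: measurableT.
have q_le v : \sum_(b : edge G | v \in ends b) (w b)%:R <= #|edge G|%:R * size_ n.
  rewrite mulr_natl -sumr_const big_mkcond/=; apply: ler_sum => b _.
  by case: ifP => // _; rewrite ler0n.
apply: lyap_drift_mass => //; rewrite ?pr_ge0 ?pr_leT//; rewrite ?ler0n ?ler1n//.
- by rewrite lern1 leq_b1.
(* A positive mass gives a legal sample point with weights [w], to which [food_weight_le]
   applies. *)
- move=> h0; have [t [[_ wt] lt]] : B !=set0.
    apply/set0P/negP => /eqP B0; move: h0; rewrite pr_False ?ltxx// => t.
    by rewrite B0.
  have := pr_crossed_lower NF aE a_uniq mB (X_discrete n) B_legal w1 B_markov q_le.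
  rewrite mulrC => /le_trans; apply.
  rewrite mulrC ler_wpM2l ?pr_ge0//.
  have S0 : 0 < size_ n by rewrite ltr0n.
  have M_le : \sum_(f : edge G | (F \in ends f) && (f != a)) (w f)%:R <= size_ n - (w a)%:R :> R.
    rewrite lerBrDl; have := food_weight_le n lt; rewrite -(ler_nat R) natr_sum.
    apply: le_trans; rewrite [leRHS](bigD1 a)//=.
    have wE f : w f = weight X n t f by rewrite -[w]wt ffunE.
    by rewrite wE lerD2l; apply: ler_sum => f _; rewrite wE.
  have := sum_dampened_le (fun f => ler0n R (w f)) M_le _ S0 edge_gt0 (erefl _).
  rewrite gerBl ler0n => /(_ isT); rewrite -/k => h1.
  rewrite -lerBrDl (le_trans h1)//.
  have -> : size_ n - k * (1 - (w a)%:R / size_ n) ^+ 2 * size_ n - (w a)%:R =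
    size_ n - (w a)%:R - k * (size_ n - (w a)%:R) ^+ 2 / size_ n by field; lra.
  by [].
- rewrite /th; case: andP => [[Ne ea]|_]; last by rewrite !mul0r.
  rewrite !mul1r.
  exact: (pr_crossed_upper NF aE a_uniq mB (X_discrete n) B_legal w1 B_markov q_le tF Ne ea).
Qed.

(** The next value is affine in two indicators on [H], by [lyap_update]; integrating it reduces the
    claim to [lyap_drift_event]. *)
Lemma lyap_drift_piece e (th := ((N \in ends e) && (e != a))%:R : R) :
  (\int[P]_(t in H) (lyap th k (size_ n.+1) (weights X n.+1 t a)%:R (weights X n.+1 t e)%:R +
      dissip th k (size_ n) (weights X n t a)%:R (weights X n t e)%:R / size_ n)%:E <=
   \int[P]_(t in H) (lyap th k (size_ n) (weights X n t a)%:R (weights X n t e)%:R)%:E)%E.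
Proof.
have [->|/set0P H0] := eqVneq H set0; first by rewrite !integral_set0.
have mcr b : measurable [set t | exists j, X n j t = Some b].
  by apply: measurable_ex => j; exact: X_discrete.
have prH Q : measurable [set t | Q t] -> P (H `&` [set t | Q t]) = (pr Q)%:E.
  by move=> mQ; rewrite prE// conull.
have PH : P H = (pr (fun=> True))%:E by rewrite -prH ?setIT//; exact: measurableT.
have sizeS : size_ n.+1 = size_ n + 1 by rewrite /size_ addSn natr1.
have := lyap_drift_event e H0; rewrite -/th => drift.
have [t0 [_ wt0]] := H0.
have w1 : 1 <= (w a)%:R :> R by rewrite ler1n -[w]wt0 ffunE weight_ge1.
have wS b : (w b)%:R <= size_ n.
  by rewrite ler_nat (leq_trans (_ : _ <= n.+1)%N)// -?[w]wt0 ?ffunE ?weight_le// ltnS leq_addr.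
have th0 : 0 <= th by rewrite ler0n.
have S0 : 0 < size_ n by rewrite ltr0n.
(* The part of the integrand that is constant on [H], dissipation included. *)
pose x := lyap th k (size_ n + 1) ((w a)%:R + 1) (w e)%:R +
  dissip th k (size_ n) (w a)%:R (w e)%:R / size_ n.
pose E := [set t | exists j, X n j t = Some e].
pose C := [set t | ~ exists j, X n j t = Some a].
have -> : (\int[P]_(t in H) (lyap th k (size_ n) (weights X n t a)%:R (weights X n t e)%:R)%:E =
    (lyap th k (size_ n) (w a)%:R (w e)%:R)%:E * P H)%E.
  by rewrite -integral_cst//; apply: eq_integral => t /set_mem[_ /= ->].
rewrite (_ : (\int[P]_(t in H) _)%E = (\int[P]_(t in H) (x + th / (size_ n + 1) * \1_E t +
    lyap_coef k (size_ n) (w a)%:R * \1_C t)%:E)%E); last first.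
  apply: eq_integral => t /set_mem[_ /= wt]; congr (_%:E).
  rewrite sizeS wt /x.
  have w'E b : weights X n.+1 t b = (w b + (b \in trace X n t))%N.
    by rewrite ffunE weightS -[w]wt ffunE.
  rewrite !w'E !natrD lyap_update// !indicE.
  have -> : t \in E = (e \in trace X n t).
    by apply/idP/idP => [/set_mem/mem_trace//|/mem_trace h]; exact/mem_set.
  have -> : t \in C = (a \notin trace X n t).
    apply/idP/negP => [/set_mem + /mem_trace//|h]; apply/mem_set => /mem_trace.
    exact: h.
  by ring.
have wa := wS a.
have x0 : 0 <= x.
  apply: addr_ge0; first by apply: lyap_ge0; rewrite ?ler0n//; lra.
  by apply: divr_ge0; [apply: dissip_ge0|lra].
have b0 : 0 <= th / (size_ n + 1) by apply: divr_ge0 => //; lra.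
have mC : measurable C by exact: measurable_not.
rewrite (integral_affine_indic P mH (mcr e) mC x0 b0 (lyap_coef_ge0 k_gt0 w1 wa)).
rewrite PH prH// (prH _ (measurable_not (mcr a))) pr_not// -!EFinM -!EFinD lee_fin.
apply: le_trans drift; rewrite le_eqVlt; apply/orP; left; apply/eqP.
by rewrite /x; ring.
Qed.

End Step.

(** * Convergence of the Lyapunov process and of the weights *)

Let Y e n t : R := lyap ((N \in ends e) && (e != a))%:R k (size_ n)
  (weights X n t a)%:R (weights X n t e)%:R.

Let V e n t : R := dissip ((N \in ends e) && (e != a))%:R k (size_ n)
  (weights X n t a)%:R (weights X n t e)%:R.

Let weight_bounds n t b : 1 <= (weights X n t b)%:R :> R /\ (weights X n t b)%:R <= size_ n.
Proof.
rewrite ffunE ler1n weight_ge1 ler_nat; split => //.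
by rewrite (leq_trans (weight_le _ _ _ _))// ltnS leq_addr.
Qed.

Let Y_ge0 e n t : 0 <= Y e n t.
Proof.
by have [? ?] := weight_bounds n t a; rewrite /Y lyap_ge0// ler0n.
Qed.

Let V_ge0 e n t : 0 <= V e n t.
Proof.
by have [? ?] := weight_bounds n t a; rewrite /V dissip_ge0// ler0n.
Qed.

Let mY e n : measurable_fun setT (Y e n).
Proof.
exact: (measurable_fun_discrete (fun w : {ffun edge G -> nat} =>
  lyap ((N \in ends e) && (e != a))%:R k (size_ n) (w a)%:R (w e)%:R) (W_discrete n)).
Qed.

Let mV e n : measurable_fun setT (V e n).
Proof.
exact: (measurable_fun_discrete (fun w : {ffun edge G -> nat} =>
  dissip ((N \in ends e) && (e != a))%:R k (size_ n) (w a)%:R (w e)%:R) (W_discrete n)).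
Qed.

Let mVS e n : measurable_fun setT (fun t => V e n t / size_ n).
Proof. by apply: measurable_funM => //; exact: measurable_cst. Qed.

(** Cuts [A] into countably many pieces according to the weights at time [n], indexed by [pickle],
    and applies [lyap_drift_piece] to each. *)
Lemma lyap_drift_past e n A : past X n A ->
  (\int[P]_(t in A) (Y e n.+1 t)%:E + \int[P]_(t in A) (V e n t / size_ n)%:E <=
   \int[P]_(t in A) (Y e n t)%:E)%E.
Proof.
move=> pA; have mA : measurable A by exact: past_measurable pA.
have mE (f : T -> R) D : measurable D -> measurable_fun setT f -> measurable_fun D (EFin \o f).
  by move=> mD mf; apply/measurable_EFinP; exact: measurable_funS mf.
have VS0 t : 0 <= V e n t / size_ n by rewrite divr_ge0.
rewrite -ge0_integralD//; last 4 first.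
- by move=> t _; rewrite lee_fin.
- exact: mE.
- by move=> t _; rewrite lee_fin.
- exact: mE.
pose A_ j := A `&` [set t | pickle (weights X n t) = j].
have AE : A = \bigcup_j A_ j.
  by apply/seteqP; split=> [t At|t [j _ []//]]; exists (pickle (weights X n t)).
have mA_ j : measurable (A_ j).
  apply: measurableI => //.
  exact: (discreteP (fun w : {ffun edge G -> nat} => pickle w = j) (W_discrete n)).
have tA : trivIset setT A_ by move=> i j _ _ [t [[_ <-] [_ <-]]].
rewrite AE !ge0_integral_bigcup// -?AE//; last 4 first.
- exact: mE.
- by move=> t _; rewrite lee_fin.
- by apply: emeasurable_funD; exact: mE.
- by move=> t _; rewrite adde_ge0// lee_fin.
apply: lee_nneseries => [j _ _|j _].
  by apply: integral_ge0 => t _; rewrite adde_ge0// lee_fin.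
have [->|/set0P[t [At tj]]] := eqVneq (A_ j) set0; first by rewrite !integral_set0.
have -> : A_ j = A `&` [set t' | weights X n t' = weights X n t].
  apply/seteqP; split=> t' [At' h]; split=> //=; last by rewrite h.
  by apply: (pcan_inj pickleK); rewrite [LHS]h.
under eq_integral do rewrite -EFinD.
exact: lyap_drift_piece.
Qed.

Lemma lyap_cvg0 e : {ae P, forall t, Y e n t @[n --> \oo] --> (0 : R)}.
Proof.
apply: (@supermartingale_cvg0 _ _ _ P (past X) _ _ _ _ (Y e) (V e) (Y_ge0 e) (V_ge0 e)
  (mY e) (mV e) _ shift).
- by move=> n A; exact: past_measurable.
- by move=> n; exact: past_setT.
- by move=> n A A'; exact: past_setI.
- by move=> n A; exact: past_mono.
- move=> n r; exact: (@past_weights _ _ _ X n (fun w : {ffun edge G -> nat} =>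
    lyap ((N \in ends e) && (e != a))%:R k (size_ n) (w a)%:R (w e)%:R < r)).
- rewrite (_ : (fun t => (Y e 0 t)%:E) =
      cst (lyap ((N \in ends e) && (e != a))%:R k (size_ 0) 1 1)%:E); last first.
    by apply/funext => t; rewrite /Y !ffunE.
  by rewrite integral_cst// [X in (_ * X)%E](probability_setT P) mule1 ltry.
- by move=> n A; exact: lyap_drift_past.
(* Since [size_ n] exceeds [n], any [n] above the threshold [S0] is large enough. *)
- move=> r r0; have [C [S0 [C0 S00 h]]] := lyap_coercive k_gt0 k_le1 r0.
  exists C, (Num.bound S0); split=> // n t hn.
  have [a1 aS] := weight_bounds n t a; have [e1 eS] := weight_bounds n t e.
  apply: h => //; rewrite ?ler0n ?lern1 ?leq_b1//.
  have := archi_boundP (ltW S00) => /ltW/le_trans; apply.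
  by rewrite ler_nat (leq_trans hn)// (leq_trans (leq_addr shift _)).
Qed.

Let size_ratio : size_ n / n%:R @[n --> \oo] --> (1 : R).
Proof.
rewrite -cvg_shiftS/=.
have -> : (fun n => size_ n.+1 / n.+1%:R) = (fun n => 1 + shift.+1%:R * harmonic n).
  apply/funext => n; rewrite /size_ -addnS natrD mulrDl.
  by rewrite divff ?pnatr_eq0.
suff : 1 + shift.+1%:R * harmonic n @[n --> \oo] --> (1 + shift.+1%:R * 0 : R).
  by rewrite mulr0 addr0.
by apply: cvgD; [exact: cvg_cst|apply: cvgMr; exact: cvg_harmonic].
Qed.

Lemma weight_cvg : {ae P, forall t,
  (((weight X n t a)%:R / n%:R : R) @[n --> \oo] --> (1 : R)) /\
  (forall e : edge G, e != a ->
    ((weight X n t e)%:R / n%:R : R) @[n --> \oo] --> (0 : R))}.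
Proof.
have legal_ae : {ae P, forall t, all_legal N F X t}.
  exists (~` all_legal N F X); split => //.
  - exact/measurableC/(measurable_all_legal antX).
  - exact: (all_legal_conull antX).
have Y_ae : {ae P, forall t, forall e, Y e n t @[n --> \oo] --> (0 : R)}.
  by apply: filter_forall => e; exact: lyap_cvg0.
apply: filterS2 legal_ae Y_ae => t lt Yt.
have ratioE (u : nat -> R) (l : R) : u n / size_ n @[n --> \oo] --> l ->
    u n / n%:R @[n --> \oo] --> l.
  move=> ul; rewrite -[l]mulr1.
  have -> : (fun n => u n / n%:R) = (fun n => u n / size_ n * (size_ n / n%:R)).
    by apply/funext => n; rewrite mulrA mulfVK ?pnatr_eq0.
  exact: cvgM ul size_ratio.
(* For the edge [a] the coefficient [th] is [0], and [Y a] dominates [1 - W_a / S]. *)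
have a_lim : (weight X n t a)%:R / size_ n @[n --> \oo] --> (1 : R).
  suff : 1 - (1 - (weight X n t a)%:R / size_ n) @[n --> \oo] --> (1 - 0 : R).
    by rewrite subr0; under eq_fun do rewrite subKr.
  apply: cvgB; first exact: cvg_cst.
  apply: (squeeze_cvgr _ (cvg_cst 0) (Yt a)); near=> n.
  have [a1 aS] := weight_bounds n t a; rewrite !ffunE in a1 aS.
  rewrite subr_ge0 ler_pdivrMr ?ltr0n// mul1r aS/=.
  by rewrite /Y !ffunE; apply: (lyap_lower _ k_gt0 k_le1 a1 aS _).1; rewrite ler0n.
split; first exact: ratioE.
have nest_lim e : N \in ends e -> e != a ->
    (weight X n t e)%:R / n%:R @[n --> \oo] --> (0 : R).
  move=> Ne ea; apply: ratioE; apply: (squeeze_cvgr _ (cvg_cst 0) (Yt e)); near=> n.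
  have [a1 aS] := weight_bounds n t a; rewrite !ffunE in a1 aS.
  rewrite divr_ge0//= /Y !ffunE Ne ea/=.
  have [_] := lyap_lower (ler0n R 1) k_gt0 k_le1 a1 aS (ler0n R (weight X n t e)).
  by rewrite mul1r.
move=> e ea; pose D e' := (N \in ends e') && (e' != a).
(* A walk that crosses [e] starts with an edge of [D], which is reinforced at the same time; the [1]
   is the initial weight of [e]. *)
have e_le n : (weight X n t e <= 1 + \sum_(e' | D e') weight X n t e')%N.
  elim: n => [|n IH]; first by rewrite leq_addr.
  rewrite weightS; under eq_bigr do rewrite weightS.
  rewrite big_split/= addnA leq_add//.
  case: (boolP (e \in trace X n t)) => // /mem_trace[j ej].
  have [e' x0 De'] := first_move (lt n) NF Fa ej ea.
  by rewrite (bigD1 e')//= (_ : e' \in _ = true)//; apply/mem_trace; exists 0.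
have sum_lim : n%:R^-1 + \sum_(e' | D e') (weight X n t e')%:R / n%:R
    @[n --> \oo] --> (0 : R).
  suff : n%:R^-1 + \sum_(e' | D e') (weight X n t e')%:R / n%:R
      @[n --> \oo] --> (0 + \sum_(e' | D e') 0 : R) by rewrite big1 ?addr0.
  apply: cvgD; first by rewrite -cvg_shiftS; exact: cvg_harmonic.
  apply: cvg_big => [|e' /andP[]]; [exact: add_continuous|exact: nest_lim].
apply: (squeeze_cvgr _ (cvg_cst 0) sum_lim); near=> n.
rewrite divr_ge0//= -mulr_suml; set x := \sum_(_ | _) _.
rewrite (_ : n%:R^-1 + x / n%:R = (1 + x) / n%:R); last by rewrite mulrDl mul1r.
rewrite ler_wpM2r ?invr_ge0// /x.
by have := e_le n; rewrite -(ler_nat R) natrD natr_sum.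
Unshelve. all: by end_near. Qed.

End Process.

Theorem theorem1p3 (R : realType) (d : measure_display) (T : measurableType d)
    (P : probability T R) (G : multigraph) (N F : vertex G) (a : edge G)
    (X : nat -> nat -> T -> option (edge G)) :
  N != F ->
  tree_like F ->
  ends a = [set N; F]%SET ->
  (forall e : edge G, ends e = [set N; F]%SET -> e = a) ->
  ant_process P N F X ->
  {ae P, forall t,
    (((weight X n t a)%:R / n%:R : R) @[n --> \oo] --> (1 : R)) /\
    (forall e : edge G, e != a ->
      ((weight X n t e)%:R / n%:R : R) @[n --> \oo] --> (0 : R))}.
Proof. by move=> NF tF aE a_uniq antX; exact: (weight_cvg NF tF aE a_uniq antX). Qed.
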